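(* Let $(\theta_n)_{n\ge 0}$ be generated by the MLMC-adaptive stochastic gradient recursion $\theta_{n+1}=\theta_n-\gamma_{n+1}A_n\widehat H^{(n+1)}$ described in the context. Assume: (i) $V:\mathbb{R}^d\to\mathbb{R}$ is differentiable and $\|\nabla V(\theta)-\nabla V(\theta')\|\le L\|\theta-\theta'\|$ for all $\theta,\theta'\in\mathbb{R}^d$; (ii) there is $G>0$ such that $\|H_\theta\|_\infty\le G$ for all $\theta\in\mathbb{R}^d$; (iii) there are constants $c_1,c_2$ such that for all $n\ge 0$, $$\left\|\mathbb{E}[\widehat H^{(n+1)}\mid\mathcal F_n]-h(\theta_n)\right\|\le \frac{c_1G}{T_{n+1}},\qquad \mathbb{E}\left[\|\widehat H^{(n+1)}\|^2\right]\le c_2G^2\log(T_{n+1});$$ (iv) for all $n\ge 0$ the matrix $A_n$ is $\mathcal F_n$-measurable and symmetric positive definite, and there are deterministic constants $0<\underline\lambda_{n+1}\le\overline\lambda_{n+1}$ with $\underline\lambda_{n+1}\le\lambda_{\min}(A_n)\le\lambda_{\max}(A_n)\le\overline\lambda_{n+1}$; (v) for all $n\ge1$, $\gamma_n\propto n^{-\gamma}$, $\underline\lambda_n\propto n^{-\underline\lambda}$, $\overline\lambda_n\propto n^{\overline\lambda}$, $T_n\propto n^{\alpha}$, where $\alpha>0$ and $\gamma,\underline\lambda,\overline\lambda\ge0$ are constants with $\gamma+\underline\lambda<1$. For $N\ge 1$ put $\varpi_N=\sum_{k=0}^N\gamma_{k+1}\underline\lambda_{k+1}$ and let $R$ be a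 random variable, independent of the algorithm, with $\mathbb{P}[R=n]=\gamma_{n+1}\underline\lambda_{n+1}/\varpi_N$ for $n\in\{0,\dots,N\}$. Then, as $N\to\infty$, $$\mathbb{E}\left[\|\nabla V(\theta_R)\|^2\right]=\mathcal O\left(\frac{1}{N^{1-\gamma-\underline\lambda}}\left\{1+\Psi_N(\alpha+\gamma-\overline\lambda)+\Phi_N(2\gamma-2\overline\lambda)\right\}\right).$$
   Context: Setting. $\|\cdot\|$ is the Euclidean norm on $\mathbb{R}^d$. The function $V$ has a global minimizer $\theta^*\in\mathbb{R}^d$. For each $\theta\in\mathbb{R}^d$, $H_\theta:\mathbb{X}\to\mathbb{R}^d$ is a measurable function on a measurable space $\mathbb{X}\subseteq\mathbb{R}^q$, $\|H_\theta\|_\infty=\sup_{x\in\mathbb{X}}\|H_\theta(x)\|$, $P_\theta$ is a Markov kernel on $\mathbb{X}$ with invariant probability $\pi_\theta$, and $h(\theta)=\mathbb{E}_{\pi_\theta}[H_\theta(X)]$. Throughout it is assumed that $h(\theta)=\nabla V(\theta)$ for all $\theta$. MLMC estimator. $(K_n)_{n\ge1}$ are i.i.d. geometric, $\mathbb{P}(K_n=k)=2^{-k}$ for $k\ge1$. $\mathcal F_0$ is trivial and $\mathcal F_n=\sigma(K_1,\mathbf X^{(1)},\dots,K_n,\mathbf X^{(n)})$. At step $n\ge0$, given $\mathcal F_n$, $\mathbf X^{(n+1)}=(X_i^{(n+1)})_{i\ge1}$ is a Markov chain with kernel $P_{\theta_n}$, and $K_{n+1}$ is independent of $\mathcal F_n$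 and $\mathbf X^{(n+1)}$. For an integer $p\ge1$ let $H_\theta^{(p)}(\mathbf x)=\frac1p\sum_{i=1}^pH_\theta(x_i)$. With $t_{n+1}=2^{K_{n+1}}$, the MLMC estimator is $$\widehat H^{(n+1)}=H_{\theta_n}(X_1^{(n+1)})+t_{n+1}\left\{H_{\theta_n}^{(t_{n+1})}(\mathbf X^{(n+1)})-H_{\theta_n}^{(t_{n+1}/2)}(\mathbf X^{(n+1)})\right\}\mathbf 1_{t_{n+1}\le T_{n+1}}.$$ Recursion. $\theta_0\in\mathbb{R}^d$ and $\theta_{n+1}=\theta_n-\gamma_{n+1}A_n\widehat H^{(n+1)}$ for $n\ge0$, with $(\gamma_n)_{n\ge1}$, $(T_n)_{n\ge1}$ positive deterministic sequences and $A_n$ a $d\times d$ preconditioning matrix. Notation. $a_n\propto n^{s}$ means $a_n=c\,n^{s}$ for all $n\ge1$ with a constant $c>0$. For $\eta\in\mathbb{R}$: $\Psi_N(\eta)=N^{1-\eta}$ if $\eta<1$, $\log N$ if $\eta=1$, $1$ if $\eta>1$; $\Phi_N(\eta)=N^{1-\eta}\log N$ if $\eta<1$, $(\log N)^2$ if $\eta=1$, $1$ if $\eta>1$. *)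

(* Defs.v *)
From HB Require Import structures.
From mathcomp Require Import all_boot all_order all_algebra.
From mathcomp Require Import all_classical all_reals all_analysis.
From mathcomp Require Import measurable_realfun.

Set Implicit Arguments.
Unset Strict Implicit.
Unset Printing Implicit Defensive.

Import Order.TTheory GRing.Theory Num.Theory.
Import numFieldNormedType.Exports.

Local Open Scope classical_set_scope.
Local Open Scope ring_scope.

(* The library norm `|x| on matrices is the sup norm, hence this definition.
   Both norms induce the same topology, so that [differentiable] is unaffected. *)
Definition enorm (R : realType) (d : nat) (x : 'cV[R]_d) : R :=
  Num.sqrt (\sum_(i < d) (x i 0) ^+ 2).

Definition grad (R : realType) (d : nat) (V : 'cV[R]_d -> R) (x : 'cV[R]_d)
    : 'cV[R]_d :=
  \col_(i < d) 'D_(delta_mx i 0) V x.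

Definition supnorm (R : realType) (d : nat) (X : Type) (f : X -> 'cV[R]_d)
    : \bar R :=
  ereal_sup [set (enorm (f x))%:E | x in [set: X]].

Definition lambda_min (R : realType) (d : nat) (A : 'M[R]_d) : R :=
  inf [set a : R | eigenvalue A a].

Definition lambda_max (R : realType) (d : nat) (A : 'M[R]_d) : R :=
  sup [set a : R | eigenvalue A a].

Definition sym_posdef (R : realType) (d : nat) (A : 'M[R]_d) : Prop :=
  A \is symmetricmx /\
  forall v : 'cV[R]_d, v != 0 -> 0 < (v^T *m A *m v) 0 0.

Definition propto (R : realType) (a : nat -> R) (s : R) : Prop :=
  exists2 c : R, 0 < c & forall n : nat, (1 <= n)%N -> a n = c * n%:R `^ s.

Definition Psi (R : realType) (N : nat) (eta : R) : R :=
  if eta < 1 then N%:R `^ (1 - eta)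
  else if eta == 1 then ln N%:R
  else 1.

Definition Phi (R : realType) (N : nat) (eta : R) : R :=
  if eta < 1 then N%:R `^ (1 - eta) * ln N%:R
  else if eta == 1 then (ln N%:R) ^+ 2
  else 1.

(* u N = O(v N) as N tends to infinity, for an extended-real valued u; in
   particular u is eventually finite. *)
Definition ebigO (R : realType) (u : nat -> \bar R) (v : nat -> R) : Prop :=
  exists C : R, \forall N \near \oo, (`|u N| <= (C * `|v N|)%:E)%E.

(* Below, sigma-algebras on Omega are represented by a generating class G, the
   sigma-algebra itself being <<s G >>. *)

Definition sigma_rv (dO dX : measure_display) (Omega : measurableType dO)
    (X : measurableType dX) (f : Omega -> X) : set (set Omega) :=
  preimage_set_system setT f measurable.

Definition measurable_wrt (dO dX : measure_display) (Omega : measurableType dO)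
    (X : measurableType dX) (G : set (set Omega)) (f : Omega -> X) : Prop :=
  measurable_fun (setT : set (g_sigma_algebraType G)) f.

Definition mx_measurable_wrt (R : realType) (dO : measure_display)
    (Omega : measurableType dO) (m n : nat) (G : set (set Omega))
    (f : Omega -> 'M[R]_(m, n)) : Prop :=
  forall i j, measurable_wrt G (fun w => f w i j).

Definition indep (R : realType) (dO : measure_display)
    (Omega : measurableType dO) (P : probability Omega R)
    (F G : set (set Omega)) : Prop :=
  forall A B, <<s F >> A -> <<s G >> B -> P (A `&` B) = (P A * P B)%E.

(* g is a version of the conditional expectation of f given <<s G >>. *)
Definition is_cond_exp (R : realType) (dO : measure_display)
    (Omega : measurableType dO) (P : probability Omega R)
    (G : set (set Omega)) (f g : Omega -> R) : Prop :=
  [/\ P.-integrable setT (EFin \o f),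
      P.-integrable setT (EFin \o g),
      measurable_wrt G g &
      forall B, <<s G >> B ->
        (\int[P]_(w in B) (g w)%:E = \int[P]_(w in B) (f w)%:E)%E].

Definition is_cond_exp_vec (R : realType) (dO : measure_display)
    (Omega : measurableType dO) (P : probability Omega R) (d : nat)
    (G : set (set Omega)) (f g : Omega -> 'cV[R]_d) : Prop :=
  forall i, is_cond_exp P G (fun w => f w i 0) (fun w => g w i 0).

(* g is a version of the conditional probability of A given <<s G >>. *)
Definition is_cond_prob (R : realType) (dO : measure_display)
    (Omega : measurableType dO) (P : probability Omega R)
    (G : set (set Omega)) (A : set Omega) (g : Omega -> \bar R) : Prop :=
  measurable_wrt G g /\
  forall B, <<s G >> B -> (\int[P]_(w in B) g w = P (A `&` B))%E.

Definition invariant_prob (R : realType) (dX : measure_display)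
    (X : measurableType dX) (Q : R.-pker X ~> X) (mu : probability X R) : Prop :=
  forall B, measurable B -> (\int[mu]_x Q x B = mu B)%E.

Definition mean_field (R : realType) (dX : measure_display)
    (X : measurableType dX) (d : nat) (H : 'cV[R]_d -> X -> 'cV[R]_d)
    (pi : 'cV[R]_d -> probability X R) (th : 'cV[R]_d) : 'cV[R]_d :=
  \col_(i < d) (\int[pi th]_(x in setT) (H th x i 0))%R.

Definition Havg (R : realType) (X : Type) (d : nat)
    (H : 'cV[R]_d -> X -> 'cV[R]_d) (th : 'cV[R]_d) (p : nat) (x : nat -> X)
    : 'cV[R]_d :=
  p%:R^-1 *: \sum_(1 <= i < p.+1) H th (x i).

(* The estimator for parameter th, sample path x (indexed from 1), level k
   (so that t = 2 ^ k) and truncation T. *)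
Definition mlmc (R : realType) (X : Type) (d : nat)
    (H : 'cV[R]_d -> X -> 'cV[R]_d) (th : 'cV[R]_d) (x : nat -> X) (k : nat)
    (T : R) : 'cV[R]_d :=
  let t := (2 ^ k)%N in
  H th (x 1%N) +
  (if t%:R <= T then t%:R *: (Havg H th t x - Havg H th (t %/ 2) x) else 0).

Section Algorithm.
Context (R : realType) (dO dX : measure_display).
Context (Omega : measurableType dO) (P : probability Omega R).
Context (X : measurableType dX) (d : nat).

(* Hhat n is the estimator computed from the n-th sample, with n >= 1. *)
Definition Hhat (H : 'cV[R]_d -> X -> 'cV[R]_d) (T : nat -> R)
    (K : nat -> {RV P >-> nat}) (Xs : nat -> nat -> {RV P >-> X})
    (theta : nat -> Omega -> 'cV[R]_d) (n : nat) (w : Omega) : 'cV[R]_d :=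
  mlmc H (theta n.-1 w) (fun i => Xs n i w) (K n w) (T n).

Definition chain_upto (Xs : nat -> nat -> {RV P >-> X}) (n i : nat)
    : set (set Omega) :=
  \bigcup_(j in [set j | (1 <= j <= i)%N]) sigma_rv (Xs n j).

Definition chain (Xs : nat -> nat -> {RV P >-> X}) (n : nat)
    : set (set Omega) :=
  \bigcup_i chain_upto Xs n i.

Definition filt (K : nat -> {RV P >-> nat}) (Xs : nat -> nat -> {RV P >-> X})
    (n : nat) : set (set Omega) :=
  \bigcup_(m in [set m | (1 <= m <= n)%N]) (sigma_rv (K m) `|` chain Xs m).

Definition filt_oo (K : nat -> {RV P >-> nat})
    (Xs : nat -> nat -> {RV P >-> X}) : set (set Omega) :=
  \bigcup_n filt K Xs n.

Definition iid_geometric (K : nat -> {RV P >-> nat}) : Prop :=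
  (forall n k : nat, (1 <= n)%N -> (1 <= k)%N ->
     P (K n @^-1` [set k]) = (2^-1 ^+ k)%:E) /\
  (* the sets B i may be taken to be full, so that this covers all finite
     subfamilies *)
  (forall (m : nat) (B : nat -> set nat),
     P (\bigcap_(i in [set i | (1 <= i <= m)%N]) (K i @^-1` B i)) =
     (\prod_(1 <= i < m.+1) P (K i @^-1` B i))%E).

Record mlmc_sgd (Q : 'cV[R]_d -> R.-pker X ~> X)
    (H : 'cV[R]_d -> X -> 'cV[R]_d) (gamma T : nat -> R)
    (K : nat -> {RV P >-> nat}) (Xs : nat -> nat -> {RV P >-> X})
    (A : nat -> Omega -> 'M[R]_d) (theta0 : 'cV[R]_d)
    (theta : nat -> Omega -> 'cV[R]_d) : Prop := {
  sgd_levels : iid_geometric K;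
  sgd_level_indep : forall n : nat,
    indep P (sigma_rv (K n.+1)) (filt K Xs n `|` chain Xs n.+1);
  sgd_markov : forall (n i : nat) (B : set X), (1 <= i)%N -> measurable B ->
    is_cond_prob P (filt K Xs n `|` chain_upto Xs n.+1 i)
      (Xs n.+1 i.+1 @^-1` B) (fun w => Q (theta n w) (Xs n.+1 i w) B);
  (* H is only assumed measurable in its second argument, so that the
     measurability of the estimators is not automatic *)
  sgd_estimator_meas : forall n : nat,
    mx_measurable_wrt (filt K Xs n.+1) (Hhat H T K Xs theta n.+1);
  sgd_init : forall w, theta 0%N w = theta0;
  sgd_step : forall (n : nat) (w : Omega),
    theta n.+1 w =
    theta n w - gamma n.+1 *: (A n w *m Hhat H T K Xs theta n.+1 w)
}.

End Algorithm.

Definition varpi (R : realType) (gamma llow : nat -> R) (N : nat) : R :=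
  \sum_(0 <= k < N.+1) gamma k.+1 * llow k.+1.

(* Main.v *)
Require Import Defs.
From HB Require Import structures.
From mathcomp Require Import all_boot all_order all_algebra.
From mathcomp Require Import all_classical all_reals all_analysis.
From mathcomp Require Import measurable_realfun.
From mathcomp Require complex.
From mathcomp Require Import zify ring lra.

Set Implicit Arguments.
Unset Strict Implicit.
Unset Printing Implicit Defensive.

Import Order.TTheory GRing.Theory Num.Theory.
Import numFieldNormedType.Exports.

Local Open Scope classical_set_scope.
Local Open Scope ring_scope.

(** Every step decreases [V] in mean by a multiple of the squared gradient, up to
    a bias and a variance term; as [V] is bounded below, the accumulated decrease
    is at most the initial gap plus the accumulated errors.

    With [x := theta n], [y := - gamma n.+1 *: (A n *m Hhat n.+1)], the
    Lipschitz gradient gives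
    [V (x + y) <= V x + <grad V x, y> + |L| * |y|^2] ([descent]). Taking
    expectations, the factor [A n *m grad V x] of the linear term is bounded
    and measurable with respect to the past, so the estimator may be replaced by
    its conditional expectation ([cond_exp_dotv]), which is [grad V x] up to an
    error of order [1 / T n.+1]. The eigenvalue bounds on [A n], in the form of
    [rayleigh_ge] and [enorm_mulmx_le], then give ([expected_descent])
      [E V (theta n.+1) + gamma llow E |grad V (theta n)|^2
         <= E V (theta n) + O (gamma lup / T) + O (gamma^2 lup^2 |ln T|)]
    where [gamma], [llow], [lup] and [T] are taken at [n.+1]. The gradient is
    bounded because it is the mean of the bounded function [H].

    Summing over [n <= N], the left-hand sides telescope and leave at least
    [V theta_star] plus [varpi N * E |grad V (theta_R)|^2], since the law of the
    random index is proportional to [gamma llow] ([random_index_le]). On the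
    right the exponents of [n] in the two error terms are [- (a + g - u)] and
    [- (2 g - 2 u)], the latter with a logarithmic factor; their partial sums
    are of order [Psi] and [Phi] ([bias_sum_le], [variance_sum_le]). Finally
    [varpi N] is at least of order [N^(1 - g - l)] ([varpi_ge]).

    One lemma, [orthogonal_bounded], underlies both probabilistic inputs: an
    integrable [D] whose integral vanishes on every event of a sub-sigma-algebra
    is orthogonal to every bounded function measurable for it. It is used with
    [D] the difference between a function and its conditional expectation, and
    with [D] the centred indicator of an independent event. *)

(** * Euclidean geometry and Rayleigh bounds *)

Section Euclidean.
Variables (R : realType) (d : nat).
Implicit Types x y z : 'cV[R]_d.

Definition dotv x y : R := \sum_(i < d) x i 0 * y i 0.

Lemma dotvC x y : dotv x y = dotv y x.
Proof. by apply: eq_bigr => i _; rewrite mulrC. Qed.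

Lemma dotvDr x y z : dotv x (y + z) = dotv x y + dotv x z.
Proof.
by rewrite -big_split; apply: eq_bigr => i _; rewrite mxE mulrDr.
Qed.

Lemma dotvZr a x y : dotv x (a *: y) = a * dotv x y.
Proof.
by rewrite /dotv mulr_sumr; apply: eq_bigr => i _; rewrite mxE mulrCA.
Qed.

Lemma dotvNr x y : dotv x (- y) = - dotv x y.
Proof. by rewrite -scaleN1r dotvZr mulN1r. Qed.

Lemma dotvBr x y z : dotv x (y - z) = dotv x y - dotv x z.
Proof. by rewrite dotvDr dotvNr. Qed.

Lemma dotvBl x y z : dotv (x - y) z = dotv x z - dotv y z.
Proof. by rewrite dotvC dotvBr !(dotvC z). Qed.

Lemma dotvZl a x y : dotv (a *: x) y = a * dotv x y.
Proof. by rewrite dotvC dotvZr dotvC. Qed.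

Lemma dotvv_ge0 x : 0 <= dotv x x.
Proof. by apply: sumr_ge0 => i _; rewrite -expr2 sqr_ge0. Qed.

Lemma enorm_ge0 x : 0 <= enorm x.
Proof. exact: sqrtr_ge0. Qed.

Lemma enorm_sqr x : enorm x ^+ 2 = dotv x x.
Proof.
rewrite /enorm sqr_sqrtr; last by apply: sumr_ge0 => i _; exact: sqr_ge0.
by apply: eq_bigr => i _; rewrite expr2.
Qed.

Lemma enormZ a x : enorm (a *: x) = `|a| * enorm x.
Proof.
apply/eqP; rewrite -(@eqrXn2 _ 2) ?mulr_ge0 ?enorm_ge0//.
by rewrite exprMn !enorm_sqr dotvZl dotvZr mulrA -expr2 real_normK ?num_real.
Qed.

Lemma enorm_coord x i : `|x i 0| <= enorm x.
Proof.
rewrite -(@ler_pXn2r _ 2) ?nnegrE ?enorm_ge0// real_normK ?num_real//.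
rewrite enorm_sqr /dotv (bigD1 i)//= -expr2 lerDl.
by apply: sumr_ge0 => j _; rewrite -expr2 sqr_ge0.
Qed.

Lemma enorm_le_sqrt_dim x (M : R) : 0 <= M -> (forall i, `|x i 0| <= M) ->
  enorm x <= Num.sqrt d%:R * M.
Proof.
move=> M0 xM.
rewrite -(@ler_pXn2r _ 2) ?nnegrE ?enorm_ge0 ?mulr_ge0 ?sqrtr_ge0//.
rewrite exprMn enorm_sqr sqr_sqrtr ?ler0n//.
rewrite -[d in d%:R]card_ord mulr_natl -sumr_const.
apply: ler_sum => i _.
by rewrite -expr2 -real_normK ?num_real// lerXn2r ?nnegrE.
Qed.

(** Expand [0 <= dotv z z] for [z := dotv y y *: x - dotv x y *: y], which is
    [dotv y y] times the component of [x] orthogonal to [y]. *)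
Lemma cauchy_schwarz x y : `|dotv x y| <= enorm x * enorm y.
Proof.
rewrite -(@ler_pXn2r _ 2) ?nnegrE ?mulr_ge0 ?enorm_ge0//.
rewrite exprMn !enorm_sqr real_normK ?num_real//.
have := dotvv_ge0 y; rewrite le_eqVlt => /orP[/eqP y0|y0].
  suff -> : dotv x y = 0 by rewrite expr0n/= mulr_ge0 ?dotvv_ge0.
  have yi i : y i 0 = 0.
    apply/eqP; rewrite -normr_le0.
    rewrite (le_trans (enorm_coord y i))//.
    by rewrite -(@ler_pXn2r _ 2) ?nnegrE ?enorm_ge0// enorm_sqr -y0 expr0n.
  by rewrite /dotv big1 // => i _; rewrite yi mulr0.
set a := dotv y y in y0 *; set b := dotv x y.
have := dotvv_ge0 (a *: x - b *: y).
rewrite dotvBl !dotvBr !dotvZl !dotvZr -/a -/b (dotvC y x) -/b.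
rewrite (_ : _ - _ = a * (dotv x x * a - b ^+ 2)); last by ring.
by rewrite pmulr_rge0// subr_ge0.
Qed.

Lemma le_dotv_enorm x y : dotv x y <= enorm x * enorm y.
Proof. exact: le_trans (ler_norm _) (cauchy_schwarz x y). Qed.

Lemma le_enorm x y : dotv x x <= dotv y y -> enorm x <= enorm y.
Proof.
by move=> h; rewrite -(@ler_pXn2r _ 2) ?nnegrE ?enorm_ge0// !enorm_sqr.
Qed.

End Euclidean.

Section Spectral.
Import complex.
Local Open Scope sesquilinear_scope.
Local Open Scope complex_scope.
Variables (R : realType) (d : nat).
Implicit Type A : 'M[R]_d.

Lemma dotv_mulmx_symm A (x y : 'cV[R]_d) : A \is symmetricmx ->
  dotv x (A *m y) = dotv (A *m x) y.
Proof.
move=> /is_hermitianmxP; rewrite expr0 scale1r map_mx_id// => AT.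
have dE (u v : 'cV[R]_d) : dotv u v = (u^T *m v) 0 0.
  by rewrite mxE; apply: eq_bigr => i _; rewrite mxE.
by rewrite !dE trmx_mul -AT mulmxA.
Qed.

(** Over the complex closure a real symmetric matrix is unitarily
    diagonalisable with real eigenvalues, so both quadratic forms
    become combinations, with the same nonnegative weights, of the
    eigenvalues and of their squares; an eigenvalue of the complexified matrix
    that is real is already an eigenvalue of the matrix itself. *)
Lemma symmetric_diagonalization A (v : 'cV[R]_d) : A \is symmetricmx ->
  exists (r q : 'I_d -> R),
  [/\ forall i, eigenvalue A (r i), forall i, 0 <= q i,
      dotv v v = \sum_i q i,
      dotv v (A *m v) = \sum_i r i * q i &
      dotv (A *m v) (A *m v) = \sum_i r i ^+ 2 * q i].
Proof.
move=> Asym.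
pose toC : {rmorphism R -> R[i]} := real_complex R.
pose Ac := map_mx toC A.
have Acsym : Ac \is symmetricmx.
  move: Asym => /is_hermitianmxP; rewrite expr0 scale1r map_mx_id// => AT.
  apply/is_hermitianmxP; rewrite expr0 scale1r map_mx_id//.
  by rewrite {1}/Ac AT map_trmx.
have Acreal : Ac \is a realmx.
  by apply/mxOverP => i j; rewrite mxE; apply/complex_realP; exists (A i j).
have Acherm := realsym_hermsym Acsym Acreal.
have /orthomx_spectralP AE := hermitian_normalmx Acherm.
have spR := hermitian_spectral_diag_real Acherm.
set U := spectralmx Ac in AE; set sp := spectral_diag Ac in AE spR.
have Uu : U \is unitarymx := spectral_unitarymx Ac.
rewrite (invmx_unitary Uu) in AE.
have /fin_all_exists[r rE] : forall i, exists k, sp 0 i = toC k.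
  by move=> i; apply/complex_realP; exact: (mxOverP spR).
pose vc : 'cV[R[i]]_d := map_mx toC v.
pose y := U *m vc.
have Ut : U^t* *m U = 1%:M.
  by rewrite -(invmx_unitary Uu) mulVmx// unitarymx_unit.
have /fin_all_exists[q qE] : forall i, exists k, (y i 0)^* * y i 0 = toC k.
  move=> i; apply/complex_realP; apply: ger0_real.
  by rewrite mulrC mul_conjC_ge0.
have q0 i : 0 <= q i.
  by rewrite -lecR -[_%:C]/(toC _) -qE mulrC mul_conjC_ge0.
(* [U] is unitary, so it preserves the Hermitian product *)
have dotC (a b : 'cV[R]_d) : toC (dotv a b) =
    \sum_i ((U *m map_mx toC a) i 0)^* * (U *m map_mx toC b) i 0.
  have -> : toC (dotv a b) = ((map_mx toC a)^t* *m map_mx toC b) 0 0.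
    rewrite mxE rmorph_sum; apply: eq_bigr => i _; rewrite !mxE rmorphM/=.
    congr (_ * _); apply/esym/CrealP/complex_realP.
    by exists (a i 0).
  rewrite -[X in _ *m X]mul1mx -Ut mulmxA -!mulmxA mulmxA.
  have -> : (map_mx toC a)^t* *m U^t* = (U *m map_mx toC a)^t*.
    by rewrite trmx_mul map_mxM.
  by rewrite mxE; apply: eq_bigr => i _; rewrite !mxE.
have UAv i : (U *m map_mx toC (A *m v)) i 0 = sp 0 i * y i 0.
  rewrite map_mxM -/Ac -/vc {1}AE !mulmxA (unitarymxP Uu) mul1mx -mulmxA.
  by rewrite -/y mul_diag_mx mxE.
have toC_inj : injective toC by exact: complexI.
exists r, q; split => //.
- move=> i; rewrite -(eigenvalue_map toC) -rE.
  apply/eigenvalueP; exists (row i U); last first.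
    apply/eqP => /(congr1 (fun X => X *m U^t*)); rewrite mul0mx -row_mul.
    rewrite (unitarymxP Uu) => /rowP/(_ i); rewrite !mxE eqxx => /eqP.
    by rewrite oner_eq0.
  rewrite -/Ac -row_mul {1}AE !mulmxA (unitarymxP Uu) mul1mx.
  by apply/rowP => j; rewrite mul_diag_mx !mxE.
- apply: toC_inj; rewrite dotC rmorph_sum; apply: eq_bigr => i _.
  by rewrite -qE.
- apply: toC_inj; rewrite dotC rmorph_sum; apply: eq_bigr => i _.
  by rewrite UAv -/vc -/y rmorphM/= -qE -rE mulrCA.
- apply: toC_inj; rewrite dotC rmorph_sum; apply: eq_bigr => i _.
  have spC : (sp 0 i)^* = sp 0 i by apply/CrealP; exact: (mxOverP spR).
  transitivity ((sp 0 i * (y i 0)^* ) * (sp 0 i * y i 0)).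
    by congr (_ * _); rewrite UAv// -[in RHS]spC -rmorphM.
  by rewrite rmorphM rmorphXn/= -qE -rE mulrACA expr2.
Qed.

Lemma rayleigh_ge A (lo : R) (v : 'cV[R]_d) : A \is symmetricmx ->
  (forall b, eigenvalue A b -> lo <= b) -> lo * enorm v ^+ 2 <= dotv v (A *m v).
Proof.
move=> /(symmetric_diagonalization v)[r [q [rA q0 vE vAE _]]] lob.
rewrite enorm_sqr vE vAE mulr_sumr; apply: ler_sum => i _.
by rewrite ler_wpM2r// lob.
Qed.

Lemma enorm_mulmx_le A (up : R) (v : 'cV[R]_d) : A \is symmetricmx ->
  0 <= up -> (forall b, eigenvalue A b -> `|b| <= up) ->
  enorm (A *m v) <= up * enorm v.
Proof.
move=> /(symmetric_diagonalization v)[r [q [rA q0 vE _ AvE]]] up0 upb.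
rewrite -(ger0_norm up0) -enormZ; apply: le_enorm.
rewrite AvE dotvZl dotvZr vE mulrA mulr_sumr; apply: ler_sum => i _.
by rewrite ler_wpM2r// -expr2 -real_normK ?num_real// lerXn2r ?nnegrE ?upb.
Qed.

(** [inf] and [sup] of a set without a bound, or of the empty set, are [0]; a
    positive lower bound on [lambda_min] therefore makes both extremal
    eigenvalues genuine bounds. *)
Lemma eigenvalue_bounds A (lo up : R) : 0 < lo -> lo <= lambda_min A ->
  lambda_min A <= lambda_max A -> lambda_max A <= up ->
  forall b, eigenvalue A b -> lo <= b <= up.
Proof.
move=> lo0 lmin lmm lmax b bA; apply/andP; split.
  apply: (le_trans lmin); apply: ge_inf => //.
  have [[]//|/inf_out] := pselect (has_inf [set a | eigenvalue A a]).
  by move=> E; move: (lt_le_trans lo0 lmin); rewrite /lambda_min E ltxx.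
apply: le_trans lmax; apply: ub_le_sup => //.
have [[]//|/sup_out] := pselect (has_sup [set a | eigenvalue A a]).
move=> E; move: (lt_le_trans lo0 (le_trans lmin lmm)).
by rewrite /lambda_max E ltxx.
Qed.

End Spectral.

(** * Descent inequality *)

Section Descent.
Variables (R : realType) (d : nat).
Implicit Types (V : 'cV[R]_d -> R) (x y : 'cV[R]_d).

Lemma derive_grad V x y : differentiable V x -> 'D_y V x = dotv (grad V x) y.
Proof.
move=> dV; rewrite deriveE// [in LHS](matrix_sum_delta y) raddf_sum.
apply: eq_bigr => i _; rewrite big_ord1 mxE deriveE// mulrC.
have linE (f : {linear 'cV[R]_d -> R}) a v : f (a *: v) = a * f v.
  exact: linearZ_LR.
exact: linE.
Qed.

(** The mean value theorem along the segment gives the constant [L] instead of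
    the sharp [L / 2], which is immaterial for orders of magnitude. *)
Lemma descent V (L : R) : (forall x, differentiable V x) ->
  (forall x y, enorm (grad V x - grad V y) <= L * enorm (x - y)) ->
  forall x y, V (x + y) <= V x + dotv (grad V x) y + `|L| * enorm y ^+ 2.
Proof.
move=> dV LV x y.
pose f (t : R) := V (x + t *: y).
have shiftE t : (fun h : R => h^-1 *: ((f \o shift t) (h *: 1) - f t)) =
    (fun h => h^-1 *: ((V \o shift (x + t *: y)) (h *: y) - V (x + t *: y))).
  apply/funext => h /=; congr (_ *: (V _ - _)).
  by rewrite [h *: 1]mulr1 scalerDl addrCA.
have fD (t : R) : is_derive t (1 : R) f (dotv (grad V (x + t *: y)) y).
  apply: DeriveDef.
    rewrite /derivable shiftE; exact: diff_derivable.
  by rewrite -derive_grad// /derive shiftE.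
have [|c /andP[c0 c1]] :=
    @MVT R f (fun t => dotv (grad V (x + t *: y)) y) 0 1 ltr01.
  by apply: derivable_within_continuous => t _.
rewrite /f scale0r scale1r addr0 subr0 mulr1 => /eqP.
rewrite subr_eq => /eqP ->; rewrite addrC -addrA lerD2l -lerBlDl -dotvBl.
rewrite (le_trans (le_dotv_enorm _ _))// expr2 mulrA ler_wpM2r ?enorm_ge0//.
rewrite (le_trans (LV _ _))// addrC addKr enormZ.
rewrite (@le_trans _ _ (`|L| * (`|c| * enorm y)))//.
  by rewrite ler_wpM2r ?mulr_ge0 ?enorm_ge0 ?ler_norm.
rewrite ler_wpM2l// -[leRHS]mul1r ler_wpM2r ?enorm_ge0//.
by rewrite ger0_norm ltW.
Qed.

End Descent.

(** * Continuous functions of measurable vectors *)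

Section Measurability.
Variable R : realType.

(** The rational boxes contained in the open set [U] cover it, and there are
    only countably many of them. *)
Lemma measurable_preimage_open dT (T : measurableType dT) (d : nat)
    (g : T -> 'cV[R]_d) (U : set 'cV[R]_d) :
  (forall i, measurable_fun setT (fun w => g w i 0)) -> open U ->
  measurable (g @^-1` U).
Proof.
move=> mg oU.
pose box (p : 'cV[rat]_d * nat) : set 'cV[R]_d :=
  [set x | forall i, `|x i 0 - ratr (p.1 i 0)| < p.2.+1%:R^-1].
have -> : g @^-1` U = \bigcup_(p in setT)
    (if asbool (box p `<=` U) then g @^-1` (box p) else set0).
  apply/seteqP; split=> w /=; last first.
    by move=> [p _]; case: asboolP => // pU; exact: pU.
  move=> /oU/nbhs_ballP[e /= e0 eU].
  have [n ne] : exists n : nat, 2 * n.+1%:R^-1 < e.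
    have [n] := ltr_add_invr (divr_gt0 e0 (ltr0n R 2)); rewrite add0r => nE.
    by exists n; rewrite mulrC -ltr_pdivlMr.
  have n0 : 0 < n.+1%:R^-1 :> R by rewrite invr_gt0.
  have /fin_all_exists[q qE] (i : 'I_d) :
      exists q : rat, `|g w i 0 - ratr q| < n.+1%:R^-1.
    have [|q] := @rat_in_itvoo R (g w i 0 - n.+1%:R^-1) (g w i 0 + n.+1%:R^-1).
      by rewrite ltrD2l gtrN.
    by rewrite in_itv/= -ltr_distlC; exists q.
  exists (\col_i q i, n) => //; case: asboolP => [_ i|[]]; first by rewrite mxE.
  move=> x xb; apply: eU; split => // i j; rewrite ord1.
  have := xb i; rewrite mxE/= => xi; rewrite /ball/=.
  rewrite (le_lt_trans (ler_distD (ratr (q i)) _ _))// (lt_trans _ ne)//.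
  by rewrite mulr2n mulrDl mul1r ltrD// distrC.
apply: countable_bigcupT_measurable => // p; case: ifP => // _.
have -> : g @^-1` (box p) = \big[setI/setT]_(i < d)
    [set w | `|g w i 0 - ratr (p.1 i 0)| < p.2.+1%:R^-1].
  rewrite -bigcap_seq; apply/seteqP; split => w /= wb i.
    by move=> _; apply: wb.
  by apply: (wb i) => /=; rewrite mem_index_enum.
apply: bigsetI_measurable => i _; rewrite -[X in measurable X]setTI.
have mi : measurable_fun setT (fun w => `|g w i 0 - ratr (p.1 i 0)|).
  by apply: measurableT_comp => //; exact: measurable_funB.
have := mi measurableT _ (measurable_itv `]-oo, (p.2.+1%:R^-1)[).
by rewrite setTI; congr measurable; apply/seteqP; split => w /=; rewrite in_itv.
Qed.

Lemma measurable_comp_continuous dT (T : measurableType dT) (d : nat)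
    (g : T -> 'cV[R]_d) (f : 'cV[R]_d -> R) :
  (forall i, measurable_fun setT (fun w => g w i 0)) -> continuous f ->
  measurable_fun setT (fun w => f (g w)).
Proof.
move=> mg /continuousP cf.
apply: (@measurability _ _ _ _ setT (fun w => f (g w)) _
  (RGenOpens.measurableE R)).
move=> _ [_ [a [b ->] <-]]; rewrite setTI.
apply: (measurable_preimage_open mg (U := f @^-1` `]a, b[)).
exact/cf/interval_open.
Qed.

End Measurability.

(** * Integration and orthogonality to a sub-sigma-algebra *)

Local Notation integ P f := (P.-integrable setT (EFin \o f)).


Section Integrals.
Context (dT : measure_display) (T : measurableType dT) (R : realType)
  (P : probability T R).
Implicit Types f h U D : T -> R.

Lemma integ_measurable f : integ P f -> measurable_fun setT f.
Proof. by move=> /measurable_int/measurable_EFinP. Qed.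

Lemma integD f h : integ P f -> integ P h -> integ P (fun w => f w + h w).
Proof. by move=> fi hi; exact: (integrableD measurableT fi hi). Qed.

Lemma integB f h : integ P f -> integ P h -> integ P (fun w => f w - h w).
Proof. by move=> fi hi; exact: (integrableB measurableT fi hi). Qed.

Lemma integZ k f : integ P f -> integ P (fun w => k * f w).
Proof. by move=> fi; exact: (integrableZl measurableT k fi). Qed.

Lemma integ_cst k : integ P (fun=> k).
Proof. exact: (finite_measure_integrable_cst P k measurableT). Qed.

Lemma integ_sum (I : Type) (s : seq I) (F : I -> T -> R) :
  (forall i, integ P (F i)) -> integ P (fun w => \sum_(i <- s) F i w).
Proof.
move=> Fi; elim: s => [|i s IH].
  rewrite (_ : (fun w => _) = fun=> 0); first exact: integ_cst.
  by apply/funext => w; rewrite big_nil.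
rewrite (_ : (fun w => _) = fun w => F i w + \sum_(j <- s) F j w).
  exact: integD.
by apply/funext => w; rewrite big_cons.
Qed.

Lemma le_integ f h : measurable_fun setT f -> (forall w, `|f w| <= `|h w|) ->
  integ P h -> integ P f.
Proof.
move=> mf fh; apply: le_integrable => //; first exact/measurable_EFinP.
by move=> w _; rewrite lee_fin.
Qed.

Lemma integ_bounded f M : measurable_fun setT f -> (forall w, `|f w| <= M) ->
  integ P f.
Proof.
move=> mf fM; apply: (le_integ mf _ (integ_cst M)) => w.
exact: le_trans (fM w) (ler_norm _).
Qed.

Lemma integ_boundedM U D M : measurable_fun setT U -> (forall w, `|U w| <= M) ->
  integ P D -> integ P (fun w => U w * D w).
Proof.
move=> mU UM Di; apply: (le_integ _ _ (integZ M Di)).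
  by apply: measurable_funM => //; exact: integ_measurable.
move=> w; rewrite !normrM ler_wpM2r//.
exact: le_trans (UM w) (ler_norm _).
Qed.

Lemma Rint_cst (k : R) : \int[P]_w k = k.
Proof.
by rewrite Rintegral_cst// [X in fine X](probability_setT P) mulr1.
Qed.

Lemma Rint_sum (I : Type) (s : seq I) (F : I -> T -> R) :
  (forall i, integ P (F i)) ->
  \int[P]_w (\sum_(i <- s) F i w) = \sum_(i <- s) \int[P]_w (F i w).
Proof.
move=> Fi; elim: s => [|i s IH].
  under eq_Rintegral do rewrite big_nil.
  by rewrite big_nil Rint_cst.
under eq_Rintegral do rewrite big_cons.
by rewrite big_cons -IH RintegralD//; exact: integ_sum.
Qed.

(** Replacing [h] by the pointwise maximum changes it on a null set only and
    makes the inequality hold everywhere. *)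
Lemma ae_le_Rint f h : integ P f -> integ P h ->
  {ae P, forall w, f w <= h w} -> \int[P]_w f w <= \int[P]_w h w.
Proof.
move=> fi hi fh.
have mf := integ_measurable fi; have mh := integ_measurable hi.
have mhf : measurable_fun setT (fun w => Num.max (f w) (h w)).
  exact: measurable_maxr.
have -> : \int[P]_w h w = \int[P]_w Num.max (f w) (h w).
  congr fine; apply: ae_eq_integral => //; try exact/measurable_EFinP.
  by apply: filterS fh => w fhw _; rewrite max_r.
have maxi : integ P (fun w => Num.max (f w) (h w)).
  apply: (@le_integ _ (fun w => `|f w| + `|h w|)) => //; last first.
    by apply: integD; exact: integrable_norm.
  move=> w; rewrite (ger0_norm (addr_ge0 _ _))//.
  by rewrite /Num.max; case: ifP => _; rewrite ?lerDl ?lerDr.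
by apply: le_Rintegral => // w _; rewrite le_max lexx.
Qed.

End Integrals.

Section Orthogonality.
Context (dO : measure_display) (Omega : measurableType dO) (R : realType)
  (P : probability Omega R) (G : set (set Omega)).
Hypothesis GM : <<s G >> `<=` measurable.
Implicit Types U D : Omega -> R.

Lemma measurable_wrt_measurable U : measurable_wrt G U -> measurable_fun setT U.
Proof. by move=> mU _ B mB; apply: GM; exact: mU. Qed.

(** Bisection: subtracting [c / 2] from [U] on the event [c / 2 <= U] does not
    change the integral, because [D] has integral zero there, and halves the
    range of [U]. *)
Lemma orthogonal_halving D : integ P D ->
  (forall B, <<s G >> B -> \int[P]_(w in B) D w = 0) ->
  forall n c U, 0 <= c -> measurable_wrt G U -> (forall w, 0 <= U w <= c) ->
  `|\int[P]_w (U w * D w)| <= c / 2 ^+ n * \int[P]_w `|D w|.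
Proof.
move=> Di D0; elim=> [|n IH] c U c0 mU Uc.
  have mU' := measurable_wrt_measurable mU.
  have Ub w : `|U w| <= c by have /andP[? ?] := Uc w; rewrite ger0_norm.
  have UDi := integ_boundedM mU' Ub Di.
  rewrite expr0 divr1 -RintegralZl//; last exact: integrable_norm.
  apply: le_trans (le_normr_Rintegral _ _) _ => //.
  apply: le_Rintegral => //; first exact: integrable_norm.
    exact: integZ (integrable_norm Di).
  by move=> w _; rewrite normrM ler_wpM2r.
pose B := [set w | c / 2 <= U w].
have sB : <<s G >> B.
  have := mU measurableT _ (measurable_itv `[c / 2, +oo[); rewrite setTI.
  by congr (<<s G >> _); apply/seteqP; split => w /=; rewrite in_itv/= andbT.
pose U' w := U w - c / 2 * \1_B w.
have mU' : measurable_wrt G U'.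
  have iB := @measurable_indic _ (g_sigma_algebraType G) R setT B sB.
  exact: (measurable_funB mU (measurable_funM (measurable_cst _) iB)).
have U'c w : 0 <= U' w <= c / 2.
  have /andP[U0 Uc'] := Uc w; rewrite /U' indicE.
  case: (boolP (w \in B)) => [|]; rewrite ?inE ?notin_setE /B/= => h.
    by rewrite mulr1; lra.
  by move/negP: h; rewrite -ltNge => h; rewrite mulr0; lra.
have U'b w : `|U' w| <= c / 2 by have /andP[? ?] := U'c w; rewrite ger0_norm.
have U'Di := integ_boundedM (measurable_wrt_measurable mU') U'b Di.
have BDi : integ P (fun w => \1_B w * D w).
  apply: (@integ_boundedM _ _ _ _ _ _ 1) => //.
    by apply: measurable_indic; exact: GM.
  by move=> w; rewrite indicE; case: (_ \in _); rewrite ?normr1 ?normr0.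
have -> : \int[P]_w (U w * D w) = \int[P]_w (U' w * D w).
  transitivity (\int[P]_w (U' w * D w + c / 2 * (\1_B w * D w))).
    by apply: eq_Rintegral => w _; rewrite /U'; ring.
  rewrite RintegralD//; last exact: integZ.
  rewrite RintegralZl// (_ : \int[P]_w (\1_B w * D w) = 0) ?mulr0 ?addr0//.
  rewrite -(D0 B sB) [RHS]Rintegral_mkcond; apply: eq_Rintegral => w _.
  by rewrite patchE indicE; case: ifP; rewrite ?mul1r ?mul0r.
rewrite (le_trans (IH (c / 2) U' _ mU' U'c)) ?divr_ge0//.
by rewrite exprS invfM -!mulrA.
Qed.

(** The constant [M] is orthogonal to [D] too, so [U] may be shifted into
    [[0, 2 * M]]; then let the number of halvings go to infinity. *)
Lemma orthogonal_bounded D U M : integ P D ->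
  (forall B, <<s G >> B -> \int[P]_(w in B) D w = 0) ->
  measurable_wrt G U -> (forall w, `|U w| <= M) ->
  \int[P]_w (U w * D w) = 0.
Proof.
move=> Di D0 mU UM.
have M0 : 0 <= M by apply: le_trans (UM point).
have half := orthogonal_halving Di D0.
have -> : \int[P]_w (U w * D w) = \int[P]_w ((U w + M) * D w).
  under [RHS]eq_Rintegral do rewrite mulrDl.
  have UDi := integ_boundedM (measurable_wrt_measurable mU) UM Di.
  rewrite RintegralD//; last exact: integZ.
  rewrite RintegralZl// D0 ?mulr0 ?addr0//.
  exact: (@measurableT _ (g_sigma_algebraType G)).
apply/eqP; rewrite -normr_le0; apply/ler_addgt0Pl => e e0; rewrite addr0.
set J := \int[P]_w `|D w|.
have J0 : 0 <= J by apply: Rintegral_ge0.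
(* enough halvings for [2 * M * J / 2 ^+ n <= e]; adding [1] to [2 * M * J]
   makes the denominator positive *)
have [n ne] := ltr_add_invr
  (divr_gt0 e0 (ltr_pwDl ltr01 (mulr_ge0 (mulr_ge0 (ler0n R 2) M0) J0))).
apply: le_trans (half n (2 * M) (fun w => U w + M) _ _ _) _.
- by rewrite mulr_ge0.
- by apply: measurable_funD.
- by move=> w; have := UM w; rewrite ler_norml; lra.
rewrite mulrAC -/J ler_pdivrMr ?exprn_gt0//.
move: ne; rewrite add0r ltr_pdivlMr ?ltr_pwDl ?mulr_ge0// => ne.
have n2 : n.+1%:R <= 2 ^+ n :> R by rewrite -natrX ler_nat ltn_expl.
have := ltW ne; rewrite mulrC ler_pdivrMr ?ltr0n// => ne'.
apply: (@le_trans _ _ (e * n.+1%:R)); last by rewrite ler_wpM2l// ltW.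
by apply: le_trans ne'; rewrite lerDr.
Qed.

End Orthogonality.

(** * Power sums *)

Section PowerSums.
Variable R : realType.
Implicit Types (x y s eta : R) (n N : nat).

Lemma ln_ge1BV x : 0 < x -> 1 - x^-1 <= ln x.
Proof.
move=> x0; have := @le_ln1Dx R (x^-1 - 1).
rewrite addrCA subrr addr0 lnV ?posrE// ltrDr invr_gt0 x0 => /(_ isT).
by rewrite lerNl opprB.
Qed.

Lemma ln_le_powR x s : 0 < x -> 0 < s -> ln x <= s^-1 * x `^ s.
Proof.
move=> x0 s0; rewrite mulrC ler_pdivlMr// mulrC -ln_powR ltW//.
by rewrite ln_sublinear// powR_gt0.
Qed.

(** Convexity of the exponential: the tangent line at [s * ln x]. For either
    sign of [s] it compares one term of a power sum with a difference of
    consecutive values of [x `^ s], so that the sums below telescope. *)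
Lemma powR_sub_ge x y s : 0 < x -> 0 < y ->
  x `^ s * (s * ln (y / x)) <= y `^ s - x `^ s.
Proof.
move=> x0 y0; have yx0 : 0 < y / x by exact: divr_gt0.
have -> : y `^ s = x `^ s * (y / x) `^ s.
  by rewrite -powRM ?ltW// mulrCA divff ?mulr1 ?gt_eqF.
rewrite -[in leRHS](mulr1 (x `^ s)) -mulrA -mulrBr ler_pM2l ?powR_gt0//.
by rewrite mul1r lerBrDl /powR gt_eqF// expR_ge1Dx.
Qed.

Lemma powRB1 x s : 0 < x -> x `^ (s - 1) = x `^ s / x.
Proof.
move=> x0; rewrite powRB; first by rewrite powRr1// ltW.
by rewrite [x == 0]gt_eqF// implybT. Qed.

Lemma onem_divS n : 1 - n.+1%:R / n.+2%:R = n.+2%:R^-1 :> R.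
Proof.
rewrite -{1}(@divff _ n.+2%:R) ?pnatr_eq0// -mulrBl -natrB// subSnn.
by rewrite mul1r.
Qed.

Lemma sum_powR_lt1 s n : 0 < s ->
  \sum_(0 <= k < n) k.+1%:R `^ (s - 1) <= 2 / s * n.+1%:R `^ s.
Proof.
move=> s0; elim: n => [|n IH].
  by rewrite big_geq// mulr_ge0 ?powR_ge0// divr_ge0 ?ltW.
rewrite big_nat_recr//= -lerBrDl; apply: (@le_trans _ _
  (2 / s * n.+2%:R `^ s - 2 / s * n.+1%:R `^ s)); last by rewrite lerD2l lerN2.
rewrite -mulrBr mulrAC ler_pdivlMr// mulrC.
apply: (@le_trans _ _ (2 * (n.+1%:R `^ s *
    (s * ln (n.+2%:R / n.+1%:R))))); last first.
  by rewrite ler_pM2l// powR_sub_ge.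
rewrite powRB1//.
have -> (p l : R) : 2 * (p * (s * l)) = s * p * (2 * l) by ring.
rewrite [leLHS]mulrA ler_wpM2l ?mulr_ge0 ?powR_ge0 ?(ltW s0)//.
apply: (@le_trans _ _ (2 * (1 - (n.+2%:R / n.+1%:R)^-1))); last first.
  by rewrite ler_pM2l// ln_ge1BV// divr_gt0.
rewrite invf_div onem_divS.
rewrite -[leLHS]mul1r ler_pdivrMr// mulrAC ler_pdivlMr// mul1r.
by rewrite -natrM ler_nat mul2n -addnn addSnnS leq_addl.
Qed.

Lemma sum_inv_le n : (0 < n)%N ->
  \sum_(0 <= k < n) k.+1%:R^-1 <= 1 + ln n%:R :> R.
Proof.
elim: n => // -[_ _|n IH _]; first by rewrite big_nat1 invr1 ln1 addr0.
rewrite big_nat_recr//= (le_trans (lerD (IH isT) (lexx _)))// -addrA lerD2l.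
rewrite -lerBrDl -ln_div ?posrE//.
by rewrite (le_trans _ (ln_ge1BV _)) ?divr_gt0// invf_div onem_divS.
Qed.

Lemma sum_powR_gt1 s n : 0 < s ->
  \sum_(0 <= k < n) k.+1%:R `^ (- s - 1) <= 1 + s^-1.
Proof.
move=> s0; case: n => [|n]; first by rewrite big_geq// addr_ge0 ?invr_ge0 ?ltW.
suff H : \sum_(0 <= k < n.+1) k.+1%:R `^ (- s - 1) <=
    1 + s^-1 - s^-1 * n.+1%:R `^ (- s).
  by rewrite (le_trans H)// gerBl mulr_ge0 ?powR_ge0// invr_ge0 ltW.
elim: n => [|n IH]; first by rewrite big_nat1 !powR1 mulr1 addrK.
have key : n.+2%:R `^ (- s - 1) <=
    s^-1 * n.+1%:R `^ (- s) - s^-1 * n.+2%:R `^ (- s).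
  rewrite -mulrBr mulrC ler_pdivlMr// (le_trans _ (powR_sub_ge _ _ _))//.
  rewrite powRB1// -mulrA ler_wpM2l ?powR_ge0// mulNr -mulrN mulrC.
  rewrite ler_wpM2l ?(ltW s0)// -lnV ?posrE ?divr_gt0// invf_div.
  by rewrite (le_trans _ (ln_ge1BV _)) ?divr_gt0// invf_div onem_divS.
by rewrite big_nat_recr//=; lra.
Qed.

(** Each of the [N.+1] terms is at least the last one. *)
Lemma sum_powR_ge s N : 0 <= s -> s <= 1 ->
  N%:R `^ (1 - s) <= \sum_(0 <= k < N.+1) k.+1%:R `^ (- s).
Proof.
move=> s0 s1; apply: (@le_trans _ _ (\sum_(0 <= k < N.+1) N.+1%:R `^ (- s))).
  rewrite big_const_nat subn0 iter_addr_0 -[leRHS]mulr_natr.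
  rewrite -{2}[N.+1%:R]powRr1// -powRD ?pnatr_eq0 ?implybT// [in leRHS]addrC.
  by rewrite ge0_ler_powR ?subr_ge0 ?nnegrE ?ler_nat.
rewrite big_nat [leRHS]big_nat; apply: ler_sum => k /= kN.
rewrite !powRN lef_pV2 ?posrE ?powR_gt0//.
by rewrite ge0_ler_powR ?nnegrE ?ler_nat.
Qed.

(** The threshold [4 = 2 ^ 2] comes from [1 / 2 <= ln 2], an instance of
    [ln_ge1BV]. *)
Lemma ln_ge1 N : (4 <= N)%N -> 1 <= ln N%:R :> R.
Proof.
move=> N4; apply: (@le_trans _ _ (ln (2 ^+ 2))).
  have := @ln_ge1BV 2 (ltr0n _ 2); rewrite lnXn// -mulr_natl; lra.
rewrite ler_ln ?posrE ?exprn_gt0// ?ltr0n -?natrX ?ler_nat//.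
by rewrite (leq_trans _ N4).
Qed.

Lemma lnS_le N : (4 <= N)%N -> ln N.+1%:R <= 2 * ln N%:R :> R.
Proof.
move=> N4; have N0 : (0 < N)%N by exact: leq_trans N4.
rewrite mulr_natl -lnXn ?ltr0n// ler_ln ?posrE ?exprn_gt0 ?ltr0n//.
rewrite -natrX ler_nat -mulnn (@leq_trans (N * 2)%N)//.
  by rewrite muln2 -addnn -addn1 leq_add2l.
by rewrite leq_mul2l (leq_trans _ N4) ?orbT.
Qed.

Lemma Psi_ge0 N eta : (0 < N)%N -> 0 <= Psi N eta.
Proof.
move=> N0; rewrite /Psi; case: ifP => _; first exact: powR_ge0.
by case: ifP => // _; rewrite ln_ge0// ler1n.
Qed.

Lemma Phi_ge0 N eta : (0 < N)%N -> 0 <= Phi N eta.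
Proof.
move=> N0; rewrite /Phi; case: ifP => _.
  by rewrite mulr_ge0 ?powR_ge0// ln_ge0// ler1n.
by case: ifP => // _; rewrite sqr_ge0.
Qed.

Lemma sum_powR_le_Psi eta : exists2 C : R, 0 <= C &
  forall N, (4 <= N)%N ->
    \sum_(0 <= k < N.+1) k.+1%:R `^ (- eta) <= C * Psi N eta.
Proof.
rewrite /Psi; have [eta1|eta1|->] := ltgtP eta 1.
- have s0 : 0 < 1 - eta by rewrite subr_gt0.
  exists (2 / (1 - eta) * 3 `^ (1 - eta)).
    by rewrite mulr_ge0 ?powR_ge0// divr_ge0 ?ltW.
  move=> N N4; have := @sum_powR_lt1 (1 - eta) N.+1 s0.
  rewrite (_ : 1 - eta - 1 = - eta); last by ring.
  move=> /le_trans; apply; rewrite -[leRHS]mulrA ler_wpM2l ?divr_ge0 ?(ltW s0)//.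
  rewrite -powRM// ge0_ler_powR ?nnegrE ?mulr_ge0 ?(ltW s0)//.
  by rewrite -natrM ler_nat; lia.
- have s0 : 0 < eta - 1 by rewrite subr_gt0.
  exists (1 + (eta - 1)^-1); first by rewrite addr_ge0 ?invr_ge0 ?ltW.
  move=> N _; have := @sum_powR_gt1 (eta - 1) N.+1 s0.
  by rewrite mulr1 (_ : - (eta - 1) - 1 = - eta)//; ring.
- exists 3 => // N N4; under eq_bigr do rewrite powR_inv1//.
  rewrite (le_trans (sum_inv_le _))//.
  have := lnS_le N4; have := ln_ge1 N4; lra.
Qed.

(** For [eta <= 1] the logarithm is bounded by its value at the end of the
    range; for [eta > 1] it is absorbed by the power [del], half of what [eta]
    exceeds [1] by, and the series still converges. *)
Lemma sum_powR_ln_le_Phi eta (a b : R) : 0 <= a -> 0 <= b ->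
  exists2 C : R, 0 <= C & forall N, (4 <= N)%N ->
    \sum_(0 <= k < N.+1) k.+1%:R `^ (- eta) * (b + a * ln k.+1%:R) <=
      C * Phi N eta.
Proof.
move=> a0 b0; have [eta1|eta1] := leP eta 1.
  have [C C0 CPsi] := sum_powR_le_Psi eta.
  exists (C * (b + 2 * a)) => [|N N4].
    by rewrite mulr_ge0// addr_ge0 ?mulr_ge0.
  have l1 := ln_ge1 N4; have l0 : 0 <= ln N%:R :> R by exact: le_trans l1.
  have -> : Phi N eta = Psi N eta * ln N%:R.
    by rewrite /Phi /Psi; case: ltgtP eta1.
  apply: (@le_trans _ _ (\sum_(0 <= k < N.+1)
      k.+1%:R `^ (- eta) * ((b + 2 * a) * ln N%:R))).
    rewrite big_nat [leRHS]big_nat; apply: ler_sum => k /= kN.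
    rewrite ler_wpM2l ?powR_ge0// mulrDl lerD ?ler_peMr//.
    rewrite -mulrA mulrCA ler_wpM2l// (le_trans _ (lnS_le N4))//.
    by rewrite ler_ln ?posrE ?ltr0n// ler_nat.
  rewrite -mulr_suml mulrACA ler_wpM2r ?mulr_ge0 ?addr_ge0 ?mulr_ge0//.
  exact: CPsi.
pose del := (eta - 1) / 2.
have del0 : 0 < del by rewrite divr_gt0// subr_gt0.
have [C C0 CPsi] := sum_powR_le_Psi eta.
have [D D0 DPsi] := sum_powR_le_Psi (eta - del).
have dl1 : 1 < eta - del by rewrite /del; lra.
exists (b * C + a / del * D) => [|N N4].
  by rewrite addr_ge0 ?mulr_ge0// invr_ge0 ltW.
have -> : Phi N eta = 1 by rewrite /Phi; case: ltgtP eta1.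
have := DPsi N N4; have := CPsi N N4.
rewrite /Psi; case: ltgtP eta1 => // _ _; case: ltgtP dl1 => // _ _.
rewrite !mulr1 => Cb Db.
apply: (@le_trans _ _ (b * (\sum_(0 <= k < N.+1) k.+1%:R `^ (- eta)) +
   a / del * (\sum_(0 <= k < N.+1) k.+1%:R `^ (- (eta - del))))).
  rewrite !mulr_sumr -big_split/= ; apply: ler_sum => k _.
  rewrite mulrDr lerD//; first by rewrite mulrC.
  rewrite mulrCA -mulrA ler_wpM2l// opprB addrC powRD; last first.
    by rewrite pnatr_eq0 implybT.
  by rewrite mulrCA ler_wpM2l ?powR_ge0// ln_le_powR.
by rewrite lerD// ler_wpM2l// mulr_ge0// invr_ge0 ltW.
Qed.

End PowerSums.

(** * One step of the recursion *)

Section GradientRegularity.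
Variables (R : realType) (d : nat) (V : 'cV[R]_d -> R) (L : R).
Hypothesis V_smooth : forall th th',
  enorm (grad V th - grad V th') <= L * enorm (th - th').

Lemma continuous_grad_coord i : continuous (fun x => grad V x i 0).
Proof.
move=> x; apply/(@cvgrPdist_lt _ _ _ (nbhs x)) => e e0; apply/nbhs_ballP.
pose K := `|L| * Num.sqrt d%:R + 1.
have K0 : 0 < K by rewrite ltr_wpDl// mulr_ge0 ?sqrtr_ge0.
have eK0 : 0 < e / K by rewrite divr_gt0.
exists (e / K) => //= y [_ xy].
have -> : grad V x i 0 - grad V y i 0 = (grad V x - grad V y) i 0.
  by rewrite !mxE.
rewrite (le_lt_trans (enorm_coord _ _))// (le_lt_trans (V_smooth _ _))//.
apply: (@le_lt_trans _ _ (`|L| * (Num.sqrt d%:R * (e / K)))).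
  apply: (@le_trans _ _ (`|L| * enorm (x - y))).
    by rewrite ler_wpM2r ?enorm_ge0 ?ler_norm.
  rewrite ler_wpM2l// enorm_le_sqrt_dim// ?ltW// => j.
  by rewrite !mxE ltW//; exact: xy.
rewrite mulrA mulrCA -[ltRHS]mulr1 ltr_pM2l// ltr_pdivrMr// mul1r.
by rewrite /K ltrDl.
Qed.

Lemma measurable_enorm_grad_sqr dT (T : measurableType dT)
    (th : T -> 'cV[R]_d) :
  (forall i, measurable_fun setT (fun w => th w i 0)) ->
  measurable_fun setT (fun w => enorm (grad V (th w)) ^+ 2).
Proof.
move=> mth; rewrite (_ : (fun w => _) = fun w =>
  \sum_(i < d) grad V (th w) i 0 * grad V (th w) i 0).
  apply: measurable_sum => i; apply: measurable_funM;
  exact: (measurable_comp_continuous mth (@continuous_grad_coord i)).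
by apply/funext => w; rewrite enorm_sqr.
Qed.

End GradientRegularity.

Section OneStep.
Context (R : realType) (dO : measure_display) (Omega : measurableType dO)
  (P : probability Omega R) (F : set (set Omega)) (d : nat).
Hypothesis FM : <<s F >> `<=` measurable.

(** Coordinatewise, [f - Y] has integral zero on the events of [<<s F>>]. *)
Lemma cond_exp_dotv (U f Y : Omega -> 'cV[R]_d) (M : R) :
  mx_measurable_wrt F U -> (forall w, enorm (U w) <= M) ->
  is_cond_exp_vec P F f Y ->
  [/\ integ P (fun w => dotv (U w) (f w)), integ P (fun w => dotv (U w) (Y w)) &
      \int[P]_w dotv (U w) (f w) = \int[P]_w dotv (U w) (Y w)].
Proof.
move=> mU UM fY.
have Ub i w : `|U w i 0| <= M := le_trans (enorm_coord _ _) (UM w).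
have mU' i := measurable_wrt_measurable FM (mU i 0).
have fi i : integ P (fun w => U w i 0 * f w i 0).
  by have [? _ _ _] := fY i; exact: (integ_boundedM (mU' i) (Ub i)).
have Yi i : integ P (fun w => U w i 0 * Y w i 0).
  by have [_ ? _ _] := fY i; exact: (integ_boundedM (mU' i) (Ub i)).
split; [exact: integ_sum|exact: integ_sum|].
rewrite /dotv !Rint_sum//; apply: eq_bigr => i _.
apply/eqP; rewrite -subr_eq0 -RintegralB//; apply/eqP.
under eq_Rintegral do rewrite -mulrBr.
have [ffi fYi _ E] := fY i.
apply: (orthogonal_bounded FM _ _ (mU i 0) (Ub i)); first exact: integB.
move=> B sB; rewrite RintegralB//; try exact: FM; last 2 first.
- by apply: integrableS ffi => //; exact: FM.
- by apply: integrableS fYi => //; exact: FM.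
by rewrite /Rintegral E// subrr.
Qed.

Variables (V : 'cV[R]_d -> R) (Vmin L M : R).
Hypothesis V_min : forall th, Vmin <= V th.
Hypothesis V_diff : forall th, differentiable V th.
Hypothesis V_smooth : forall th th',
  enorm (grad V th - grad V th') <= L * enorm (th - th').
Hypothesis grad_bounded : forall th, enorm (grad V th) <= M.

Variables (th th' Hh Y : Omega -> 'cV[R]_d) (A : Omega -> 'M[R]_d).
Variables (gam lo up beta sigma : R).
Hypothesis th_meas : mx_measurable_wrt F th.
Hypothesis A_meas : mx_measurable_wrt F A.
Hypothesis A_sym : forall w, A w \is symmetricmx.
Hypothesis A_eig : forall w b, eigenvalue (A w) b -> lo <= b <= up.
Hypotheses (gam_ge0 : 0 <= gam) (lo_ge0 : 0 <= lo) (lo_up : lo <= up).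
Hypothesis Y_cond : is_cond_exp_vec P F Hh Y.
Hypothesis Y_bias : {ae P, forall w, enorm (Y w - grad V (th w)) <= beta}.
Hypothesis Hh_L2 : integ P (fun w => enorm (Hh w) ^+ 2).
Hypothesis Hh_sigma : \int[P]_w (enorm (Hh w) ^+ 2) <= sigma.
Hypothesis th'E : forall w, th' w = th w - gam *: (A w *m Hh w).
Hypothesis V_int : integ P (fun w => V (th w)).

(** Taking the expectation of the descent inequality, the linear term sees only
    the conditional expectation [Y] of the estimator because its other factor
    [A *m grad V th] is bounded and measurable with respect to the past; the
    bias of [Y] then costs at most [up * M * beta]. The lower bound on [V] makes
    [V th'] integrable, so that the step can be iterated. *)
Lemma expected_descent :
  integ P (fun w => V (th' w)) /\
  \int[P]_w V (th' w) + gam * lo * \int[P]_w (enorm (grad V (th w)) ^+ 2) <=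
  \int[P]_w V (th w) + gam * up * M * beta + `|L| * gam ^+ 2 * up ^+ 2 * sigma.
Proof.
have up0 : 0 <= up := le_trans lo_ge0 lo_up.
pose U w := A w *m grad V (th w).
have A_up w (v : 'cV[R]_d) : enorm (A w *m v) <= up * enorm v.
  apply: enorm_mulmx_le => // b /A_eig/andP[lob bup].
  by rewrite ger0_norm// (le_trans lo_ge0).
have UM w : enorm (U w) <= up * M.
  by rewrite (le_trans (A_up _ _))// ler_wpM2l.
have mgrad i : measurable_wrt F (fun w => grad V (th w) i 0).
  apply: (@measurable_comp_continuous _ _ (g_sigma_algebraType F) d th
    (fun x => grad V x i 0)); first by move=> j; exact: th_meas.
  exact: continuous_grad_coord V_smooth i.
have mU : mx_measurable_wrt F U.
  move=> i j; rewrite ord1.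
  rewrite (_ : (fun w => _) = fun w => \sum_k A w i k * grad V (th w) k 0).
    by apply: measurable_sum => k; apply: measurable_funM;
      [exact: A_meas|exact: mgrad].
  by apply/funext => w; rewrite !mxE.
have [UHi UYi UHY] := cond_exp_dotv mU UM Y_cond.
pose B w := V (th w) - gam * dotv (U w) (Hh w) +
  `|L| * gam ^+ 2 * up ^+ 2 * enorm (Hh w) ^+ 2.
(* symmetry moves [A] from the estimator to the gradient *)
have descB w : V (th' w) <= B w.
  rewrite th'E (le_trans (descent V_diff V_smooth _ _))// -scalerN /B.
  rewrite dotvZr dotvNr mulrN -dotv_mulmx_symm// lerD2l.
  rewrite -[leRHS]mulrA -[leRHS]mulrA ler_wpM2l// enormZ exprMn real_normK ?num_real//.
  rewrite ler_wpM2l ?sqr_ge0// -exprMn lerXn2r ?nnegrE ?mulr_ge0 ?enorm_ge0//.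
  by rewrite -mulmxN (le_trans (A_up _ _))// -scaleN1r enormZ normrN1 mul1r.
have Bi : integ P B.
  by apply: integD; [apply: integB => //; exact: integZ|exact: integZ].
have mHh i : measurable_fun setT (fun w => Hh w i 0).
  by have [h _ _ _] := Y_cond i; exact: integ_measurable h.
have mth' i : measurable_fun setT (fun w => th' w i 0).
  rewrite (_ : (fun w => _) = fun w =>
      th w i 0 - gam * \sum_k A w i k * Hh w k 0).
    apply: measurable_funB.
      exact: measurable_wrt_measurable (th_meas i 0).
    apply: measurable_funM => //; apply: measurable_sum => k.
    apply: measurable_funM => //.
    exact: measurable_wrt_measurable (A_meas i k).
  by apply/funext => w; rewrite th'E !mxE.
have mV' : measurable_fun setT (fun w => V (th' w)).
  by apply: measurable_comp_continuous => // x; exact: differentiable_continuous.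
(* [V (th' w)] lies between the constant [Vmin] and the integrable [B w] *)
have V'i : integ P (fun w => V (th' w)).
  apply: (@le_integ _ _ _ _ _ (fun w => `|Vmin| + `|B w|)) => //; last first.
    by apply: integD; [exact: integ_cst|exact: integrable_norm].
  move=> w; rewrite (ger0_norm (addr_ge0 _ _))// ler_norml.
  have := V_min (th' w); have := descB w.
  have := ler_norm (B w); have := normr_ge0 (B w).
  have := ler_norm Vmin; have := ler_norm (- Vmin); rewrite normrN; lra.
split => //.
have lin : lo * \int[P]_w (enorm (grad V (th w)) ^+ 2) - up * M * beta <=
    \int[P]_w dotv (U w) (Hh w).
  have g2i : integ P (fun w => enorm (grad V (th w)) ^+ 2).
    apply: (@integ_bounded _ _ _ _ _ (M ^+ 2)) => [|w].
      apply: measurable_enorm_grad_sqr V_smooth _ _ _ _ => i.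
      exact: measurable_wrt_measurable (th_meas i 0).
    rewrite ger0_norm ?sqr_ge0// lerXn2r ?nnegrE ?enorm_ge0//.
    exact: le_trans (enorm_ge0 _) (grad_bounded (th w)).
  rewrite UHY -RintegralZl// -[up * M * beta](Rint_cst P) -RintegralB//; last 2 first.
  - exact: integZ.
  - exact: integ_cst.
  apply: ae_le_Rint => //; first by apply: integB; [exact: integZ|exact: integ_cst].
  apply: filterS Y_bias => w Yw.
  have -> : dotv (U w) (Y w) =
      dotv (U w) (grad V (th w)) - dotv (U w) (grad V (th w) - Y w).
    by rewrite dotvBr opprB addrC subrK.
  rewrite lerB//; first by rewrite dotvC; apply: rayleigh_ge => // b /A_eig/andP[].
  rewrite (le_trans (le_dotv_enorm _ _))// ler_pM ?enorm_ge0//.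
  by rewrite -opprB -scaleN1r enormZ normrN1 mul1r.
have step : \int[P]_w V (th' w) <= \int[P]_w B w by exact: le_Rintegral.
have BE : \int[P]_w B w = \int[P]_w V (th w) - gam * \int[P]_w dotv (U w) (Hh w)
    + `|L| * gam ^+ 2 * up ^+ 2 * \int[P]_w (enorm (Hh w) ^+ 2).
  rewrite RintegralD//; last exact: integZ; last by apply: integB => //; exact: integZ.
  by rewrite RintegralB//; [rewrite !RintegralZl|exact: integZ].
have quad : `|L| * gam ^+ 2 * up ^+ 2 * \int[P]_w (enorm (Hh w) ^+ 2) <=
    `|L| * gam ^+ 2 * up ^+ 2 * sigma.
  by rewrite ler_wpM2l// !mulr_ge0 ?sqr_ge0.
have := ler_wpM2l gam_ge0 lin; rewrite mulrBr; move: step quad; rewrite BE.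
rewrite !mulrA; lra.
Qed.

End OneStep.

(** * Filtration and random index *)

Section Filtration.
Context (R : realType) (dO dX : measure_display) (Omega : measurableType dO)
  (P : probability Omega R) (X : measurableType dX).
Variables (K : nat -> {RV P >-> nat}) (Xs : nat -> nat -> {RV P >-> X}).

Lemma sigma_rv_measurable dY (Y : measurableType dY) (f : {RV P >-> Y}) :
  sigma_rv f `<=` measurable.
Proof. by move=> _ [B mB <-]; exact: measurable_funP. Qed.

Lemma filt_measurable n : <<s filt K Xs n >> `<=` measurable.
Proof.
apply: smallest_sub; first exact: sigma_algebra_measurable.
move=> B [m _ [|[i _ [j _]]]]; exact: sigma_rv_measurable.
Qed.

Lemma filt_leS n : filt K Xs n `<=` filt K Xs n.+1.
Proof.
by move=> B [m /= /andP[m1 mn] mB]; exists m => //=; rewrite m1 leqW.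
Qed.

Lemma measurable_wrt_sub dY (Y : measurableType dY) (F G : set (set Omega))
    (f : Omega -> Y) : F `<=` G -> measurable_wrt F f -> measurable_wrt G f.
Proof.
move=> FG mf _ B mB; have := mf measurableT B mB.
exact: (sub_smallest2r (smallest_sigma_algebra _ _) FG).
Qed.

End Filtration.

Section RandomIndex.
Context (R : realType) (dO : measure_display) (Omega : measurableType dO)
  (P : probability Omega R) (G : set (set Omega)).
Hypothesis GM : <<s G >> `<=` measurable.

(** Orthogonality of [f] to the centred indicator [\1_E - P E]. *)
Lemma indep_integral (E : set Omega) (f : Omega -> R) (M : R) :
  measurable E -> (forall B, <<s G >> B -> P (E `&` B) = (P E * P B)%E) ->
  measurable_wrt G f -> (forall w, `|f w| <= M) ->
  \int[P]_w (\1_E w * f w) = fine (P E) * \int[P]_w f w.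
Proof.
move=> mE EG mf fM; have mf' := measurable_wrt_measurable GM mf.
have fi := integ_bounded P mf' fM.
have iE : integ P (\1_E : Omega -> R) by exact: integrable_indic.
have E1 w : `|\1_E w| <= 1 :> R.
  by rewrite indicE; case: (_ \in _); rewrite ?normr1 ?normr0.
have Efi := integ_boundedM (measurable_indic mE) E1 fi.
apply/eqP; rewrite -subr_eq0 -RintegralZl// -RintegralB//; last exact: integZ.
apply/eqP; rewrite -[RHS](@orthogonal_bounded _ _ _ P G GM
  (fun w => \1_E w - fine (P E)) f M) //.
- by apply: eq_Rintegral => w _; ring.
- by apply: integB => //; exact: integ_cst.
- move=> B sB; have mB := GM sB.
  rewrite RintegralB//; last 2 first.
  + exact: integrableS iE.
  + exact: integrableS (integ_cst P _).
  rewrite Rintegral_cst// /Rintegral integral_indic//.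
  rewrite [X in fine X](EG B sB) fineM; [|exact: fin_num_measure..].
  by rewrite subrr.
Qed.

(** The indicator of [N < tau] is one minus those of [tau = n], [n <= N];
    bounding [f (tau w) w] by [M] there costs [M] times the missing mass, which
    is zero. *)
Lemma random_index_le (tau : {RV P >-> nat}) (N : nat) (p : nat -> R)
    (f : nat -> Omega -> R) (M : R) :
  indep P (sigma_rv tau) G ->
  (forall n, (n <= N)%N -> P (tau @^-1` [set n]) = (p n)%:E) ->
  \sum_(0 <= n < N.+1) p n = 1 ->
  (forall n, measurable_wrt G (f n)) -> (forall n w, 0 <= f n w <= M) ->
  integ P (fun w => f (tau w) w) /\
  \int[P]_w f (tau w) w <= \sum_(0 <= n < N.+1) p n * \int[P]_w f n w.
Proof.
move=> tauG taup p1 mf fM.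
have mE n : measurable (tau @^-1` [set n]).
  by rewrite -[X in measurable X]setTI; exact: measurable_funP.
have fM' n w : `|f n w| <= M by have /andP[? ?] := fM n w; rewrite ger0_norm.
have mft : measurable_fun setT (fun w => f (tau w) w).
  move=> _ B mB; rewrite setTI.
  rewrite (_ : _ @^-1` _ = \bigcup_n (tau @^-1` [set n] `&` f n @^-1` B)).
    apply: bigcupT_measurable => n; apply: measurableI => //.
    rewrite -[X in measurable X]setTI.
    exact: (measurable_wrt_measurable GM (mf n)).
  apply/seteqP; split => [w fw|w [n _ [/= <-]]//].
  by exists (tau w).
have fi : integ P (fun w => f (tau w) w).
  exact: (integ_bounded P mft (fun w => fM' _ w)).
split => //.
have E1 n w : `|\1_(tau @^-1` [set n]) w| <= 1 :> R.
  by rewrite indicE; case: (_ \in _); rewrite ?normr1 ?normr0.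
have fni n := integ_bounded P (measurable_wrt_measurable GM (mf n)) (fM' n).
have Efi n : integ P (fun w => \1_(tau @^-1` [set n]) w * f n w).
  exact: (integ_boundedM (measurable_indic (mE n)) (E1 n) (fni n)).
have Ei n : integ P (\1_(tau @^-1` [set n]) : Omega -> R).
  exact: integrable_indic.
pose g w := \sum_(0 <= n < N.+1) \1_(tau @^-1` [set n]) w * f n w +
  M * (1 - \sum_(0 <= n < N.+1) \1_(tau @^-1` [set n]) w).
have si : integ P (fun w =>
    \sum_(0 <= n < N.+1) \1_(tau @^-1` [set n]) w * f n w).
  exact: integ_sum.
have s1i : integ P (fun w => \sum_(0 <= n < N.+1) \1_(tau @^-1` [set n]) w : R).
  exact: integ_sum.
have d1i : integ P (fun w => 1 - \sum_(0 <= n < N.+1) \1_(tau @^-1` [set n]) w).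
  by apply: integB => //; exact: integ_cst.
have indE w n : \1_(tau @^-1` [set n]) w = (tau w == n)%:R :> R.
  rewrite indicE; congr (_%:R); congr nat_of_bool.
  by apply/idP/eqP; rewrite inE.
have fg w : f (tau w) w <= g w.
  rewrite /g; have [tN|tN] := leqP (tau w) N.
    have pick (h : nat -> R) :
        \sum_(0 <= n < N.+1) \1_(tau @^-1` [set n]) w * h n = h (tau w).
      rewrite (bigD1_seq (tau w)) ?iota_uniq ?mem_index_iota//= big1 ?addr0.
        by rewrite indE eqxx mul1r.
      by move=> n ntau; rewrite indE eq_sym (negbTE ntau) mul0r.
    have := pick (fun=> 1); under eq_bigr do rewrite mulr1.
    by move=> ->; rewrite pick subrr mulr0 addr0.
  have zero n : (0 <= n < N.+1)%N -> \1_(tau @^-1` [set n]) w = 0 :> R.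
    move=> /= nN; rewrite indE; case: eqP => // tn.
    by move: tN; rewrite tn ltnNge -ltnS nN.
  rewrite big_nat big1 => [|n nN]; last by rewrite zero// mul0r.
  rewrite [X in 1 - X]big_nat big1 => [|n nN]; last by rewrite zero.
  by rewrite add0r subr0 mulr1; have /andP[] := fM (tau w) w.
apply: (@le_trans _ _ (\int[P]_w g w)).
  apply: le_Rintegral => //; apply: integD => //; exact: integZ.
rewrite RintegralD//; last exact: integZ.
rewrite RintegralZl// RintegralB//; last exact: integ_cst.
rewrite Rint_cst !Rint_sum//.
have -> : \sum_(0 <= n < N.+1) \int[P]_w \1_(tau @^-1` [set n]) w = 1.
  rewrite -p1 big_nat [RHS]big_nat; apply: eq_bigr => n /= nN.
  by rewrite /Rintegral integral_indic// setIT [X in fine X](taup n nN).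
rewrite subrr mulr0 addr0 le_eqVlt; apply/orP; left; apply/eqP.
rewrite big_nat [RHS]big_nat; apply: eq_bigr => n /= nN.
have sE : <<s sigma_rv tau >> (tau @^-1` [set n]).
  by apply: sub_sigma_algebra; exists [set n] => //; rewrite setTI.
rewrite (indep_integral (mE n) (fun B sB => tauG _ _ sE sB) (mf n) (fM' n)).
by rewrite [X in fine X](taup n nN).
Qed.

End RandomIndex.

(** * Rates and conclusion *)

Section Rates.
Variable R : realType.
Implicit Types (gamma lup llow T : nat -> R) (g u l a : R).

Lemma bias_sum_le gamma lup T g u a :
  propto gamma (- g) -> propto lup u -> propto T a ->
  exists2 C : R, 0 <= C & forall N, (4 <= N)%N ->
    \sum_(0 <= k < N.+1) gamma k.+1 * lup k.+1 / T k.+1 <=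
      C * Psi N (a + g - u).
Proof.
move=> [cg cg0 gE] [cu cu0 uE] [cT cT0 TE].
have [C C0 CPsi] := sum_powR_le_Psi (a + g - u).
exists (cg * cu / cT * C) => [|N N4].
  by rewrite !mulr_ge0 ?invr_ge0// ltW.
apply: (@le_trans _ _ (cg * cu / cT *
    \sum_(0 <= k < N.+1) k.+1%:R `^ (- (a + g - u)))); last first.
  by rewrite -[leRHS]mulrA ler_wpM2l ?CPsi// !mulr_ge0 ?invr_ge0// ltW.
rewrite mulr_sumr le_eqVlt; apply/orP; left; apply/eqP; apply: eq_bigr => k _.
rewrite gE// uE// TE// (_ : - (a + g - u) = - g + u + - a); last by ring.
rewrite !powRD ?pnatr_eq0 ?implybT// [X in _ = _ * (_ * X)]powRN invfM.
by ring.
Qed.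

Lemma variance_sum_le gamma lup T g u a : 0 <= a ->
  propto gamma (- g) -> propto lup u -> propto T a ->
  exists2 C : R, 0 <= C & forall N, (4 <= N)%N ->
    \sum_(0 <= k < N.+1) gamma k.+1 ^+ 2 * lup k.+1 ^+ 2 * `|ln (T k.+1)| <=
      C * Phi N (2 * g - 2 * u).
Proof.
move=> a0 [cg cg0 gE] [cu cu0 uE] [cT cT0 TE].
have [C C0 CPhi] :=
  sum_powR_ln_le_Phi (2 * g - 2 * u) a0 (normr_ge0 (ln cT)).
exists (cg ^+ 2 * cu ^+ 2 * C) => [|N N4]; first by rewrite !mulr_ge0// ltW.
apply: (@le_trans _ _ (cg ^+ 2 * cu ^+ 2 * \sum_(0 <= k < N.+1)
    k.+1%:R `^ (- (2 * g - 2 * u)) * (`|ln cT| + a * ln k.+1%:R))); last first.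
  by rewrite -[leRHS]mulrA ler_wpM2l ?CPhi// mulr_ge0 ?sqr_ge0.
rewrite mulr_sumr; apply: ler_sum => k _.
rewrite gE// uE// TE// !exprMn.
have sq (s : R) : (k.+1%:R `^ s) ^+ 2 = k.+1%:R `^ (2 * s).
  by rewrite -powR_mulrn ?powR_ge0// -powRrM mulrC.
rewrite !sq (_ : - (2 * g - 2 * u) = 2 * - g + 2 * u); last by ring.
rewrite powRD ?pnatr_eq0 ?implybT//.
have -> (x y b c e : R) : x * b * (y * c) * e = x * y * (b * c * e) by ring.
apply: ler_wpM2l; first by rewrite mulr_ge0 ?sqr_ge0.
apply: ler_wpM2l; first by rewrite mulr_ge0 ?powR_ge0.
rewrite lnM ?posrE ?powR_gt0 ?ltr0n// ln_powR (le_trans (ler_normD _ _))//.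
by rewrite lerD2l normrM ger0_norm// ger0_norm// ln_ge0// ler1n.
Qed.

Lemma varpi_ge gamma llow g l : 0 <= g + l -> g + l <= 1 ->
  propto gamma (- g) -> propto llow (- l) ->
  exists2 c : R, 0 < c & forall N, (0 < N)%N ->
    c * N%:R `^ (1 - g - l) <= varpi gamma llow N.
Proof.
move=> gl0 gl1 [cg cg0 gE] [cl cl0 lE].
exists (cg * cl) => [|N N0]; first exact: mulr_gt0.
rewrite -addrA -opprD (le_trans (ler_wpM2l _ (sum_powR_ge N gl0 gl1)))//.
  by rewrite mulr_ge0// ltW.
rewrite mulr_sumr le_eqVlt; apply/orP; left; apply/eqP; apply: eq_bigr => k _.
by rewrite gE// lE// opprD powRD ?pnatr_eq0 ?implybT// mulrACA.
Qed.

Lemma telescoped_recursion (v e b : nat -> R) :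
  (forall n, v n.+1 + e n <= v n + b n) ->
  forall n, v n + \sum_(0 <= k < n) e k <= v 0%N + \sum_(0 <= k < n) b k.
Proof.
move=> step; elim=> [|n IH]; first by rewrite !big_geq.
rewrite !big_nat_recr//=; have := step n; lra.
Qed.

End Rates.

(** Coordinatewise estimates suffice, at the price of the factor [sqrt d], which
    does not affect the order in [N]. *)
Lemma enorm_mean_field_le (R : realType) (dX : measure_display)
    (X : measurableType dX) (d : nat) (H : 'cV[R]_d -> X -> 'cV[R]_d)
    (pi : 'cV[R]_d -> probability X R) (G : R) (th : 'cV[R]_d) :
  0 <= G -> (forall i, measurable_fun setT (fun x => H th x i 0)) ->
  (supnorm (H th) <= G%:E)%E ->
  enorm (mean_field H pi th) <= Num.sqrt d%:R * G.
Proof.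
move=> G0 mH HG; apply: enorm_le_sqrt_dim => // i; rewrite mxE.
have Hi x : `|H th x i 0| <= G.
  rewrite (le_trans (enorm_coord _ _))// -lee_fin (le_trans _ HG)//.
  by apply: ereal_sup_ubound; exists x.
have Hint := integ_bounded (pi th) (mH i) Hi.
rewrite (le_trans (le_normr_Rintegral _ _))// -[leRHS](Rint_cst (pi th)).
by apply: le_Rintegral => //; [exact: integrable_norm|exact: integ_cst].
Qed.

Lemma integ_of_finite_integral (R : realType) (dO : measure_display)
    (Omega : measurableType dO) (P : probability Omega R) (f : Omega -> R)
    (s : R) :
  measurable_fun setT f -> (forall w, 0 <= f w) ->
  ('E_P[f] <= s%:E)%E ->
  integ P f /\ \int[P]_w f w <= s.
Proof.
rewrite unlock => mf f0 fs.
have fi : integ P f.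
  apply/integrableP; split; first exact/measurable_EFinP.
  under eq_integral do rewrite gee0_abs ?lee_fin//.
  exact: le_lt_trans fs (ltry _).
split => //; rewrite -lee_fin /Rintegral fineK//; exact: integrable_fin_num.
Qed.

Theorem corollary3p2
  (R : realType) (dO dX : measure_display)
  (Omega : measurableType dO) (P : probability Omega R)
  (* the measurable space X, a subset of R^q through emb *)
  (X : measurableType dX) (q : nat) (emb : X -> 'cV[R]_q)
  (emb_inj : injective emb)
  (d : nat)
  (V : 'cV[R]_d -> R) (theta_star : 'cV[R]_d)
  (V_min : forall th, V theta_star <= V th)
  (H : 'cV[R]_d -> X -> 'cV[R]_d)
  (H_meas : forall th i, measurable_fun setT (fun x => H th x i 0))
  (Q : 'cV[R]_d -> R.-pker X ~> X)
  (pi : 'cV[R]_d -> probability X R)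
  (pi_inv : forall th, invariant_prob (Q th) (pi th))
  (h_grad : forall th, mean_field H pi th = grad V th)
  (K : nat -> {RV P >-> nat}) (Xs : nat -> nat -> {RV P >-> X})
  (gamma T llow lup : nat -> R)
  (A : nat -> Omega -> 'M[R]_d)
  (theta0 : 'cV[R]_d) (theta : nat -> Omega -> 'cV[R]_d)
  (algo : mlmc_sgd Q H gamma T K Xs A theta0 theta)
  (* (i) *)
  (L : R)
  (V_diff : forall th, differentiable V th)
  (V_smooth : forall th th',
     enorm (grad V th - grad V th') <= L * enorm (th - th'))
  (* (ii) *)
  (G : R) (G_gt0 : 0 < G)
  (H_bounded : forall th, (supnorm (H th) <= G%:E)%E)
  (* (iii) *)
  (c1 c2 : R)
  (bias : forall n : nat, exists Y : Omega -> 'cV[R]_d,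
     is_cond_exp_vec P (filt K Xs n) (Hhat H T K Xs theta n.+1) Y /\
     {ae P, forall w,
        enorm (Y w - mean_field H pi (theta n w)) <= c1 * G / T n.+1})
  (second_moment : forall n : nat,
     ('E_P[(fun w => enorm (Hhat H T K Xs theta n.+1 w) ^+ 2)%R]
        <= (c2 * G ^+ 2 * ln (T n.+1))%:E)%E)
  (* (iv) *)
  (A_meas : forall n : nat, mx_measurable_wrt (filt K Xs n) (A n))
  (A_posdef : forall (n : nat) w, sym_posdef (A n w))
  (lambda_bounds : forall n : nat, 0 < llow n.+1 <= lup n.+1)
  (A_bounds : forall (n : nat) w,
     llow n.+1 <= lambda_min (A n w) /\
     lambda_min (A n w) <= lambda_max (A n w) /\
     lambda_max (A n w) <= lup n.+1)
  (* (v) *)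
  (g l u a : R)
  (a_gt0 : 0 < a) (g_ge0 : 0 <= g) (l_ge0 : 0 <= l) (u_ge0 : 0 <= u)
  (gl_lt1 : g + l < 1)
  (gamma_pow : propto gamma (- g))
  (llow_pow : propto llow (- l))
  (lup_pow : propto lup u)
  (T_pow : propto T a)
  (* the random index: tau N is the variable R attached to the horizon N *)
  (tau : nat -> {RV P >-> nat})
  (tau_indep : forall N : nat, (1 <= N)%N ->
     indep P (sigma_rv (tau N)) (filt_oo K Xs))
  (tau_law : forall N n : nat, (1 <= N)%N -> (n <= N)%N ->
     P (tau N @^-1` [set n]) =
     (gamma n.+1 * llow n.+1 / varpi gamma llow N)%:E) :
  ebigO
    (fun N => 'E_P[(fun w => enorm (grad V (theta (tau N w) w)) ^+ 2)%R])%E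
    (fun N => (N%:R `^ (1 - g - l))^-1 *
              (1 + Psi N (a + g - u) + Phi N (2 * g - 2 * u))).
Proof.
(* adaptedness: each increment is a product of adapted factors *)
have mtheta n i : measurable_wrt (filt K Xs n) (fun w => theta n w i 0).
  elim: n i => [|n IH] i.
    rewrite (_ : (fun w => _) = cst (theta0 i 0)); first exact: measurable_cst.
    by apply/funext => w; rewrite (sgd_init algo).
  rewrite (_ : (fun w => _) = fun w => theta n w i 0 -
      gamma n.+1 * \sum_k A n w i k * Hhat H T K Xs theta n.+1 w k 0).
    have up := measurable_wrt_sub (@filt_leS _ _ _ _ P _ K Xs n).
    apply: measurable_funB; first exact: up (IH i).
    apply: measurable_funM; first exact: measurable_cst.
    apply: measurable_sum => k; apply: measurable_funM.
      exact: up (A_meas n i k).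
    exact: (sgd_estimator_meas algo k 0).
  by apply/funext => w; rewrite (sgd_step algo) !mxE.
have mth n : mx_measurable_wrt (filt K Xs n) (theta n).
  by move=> i j; rewrite ord1.
pose M := Num.sqrt d%:R * G.
have grad_M th : enorm (grad V th) <= M.
  by rewrite -h_grad; apply: enorm_mean_field_le => //; exact: ltW.
have gam_gt0 n : 0 < gamma n.+1.
  by have [c c0 E] := gamma_pow; rewrite E// mulr_gt0// powR_gt0.
have T_gt0 n : 0 < T n.+1.
  by have [c c0 E] := T_pow; rewrite E// mulr_gt0// powR_gt0.
have low_gt0 n : 0 < llow n.+1 by have /andP[] := lambda_bounds n.
have low_up n : llow n.+1 <= lup n.+1 by have /andP[] := lambda_bounds n.
have up_gt0 n : 0 < lup n.+1 := lt_le_trans (low_gt0 n) (low_up n).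
pose beta n := `|c1| * G / T n.+1.
pose sigma n := `|c2| * G ^+ 2 * `|ln (T n.+1)|.
pose v n := \int[P]_w V (theta n w).
pose g2 n := \int[P]_w (enorm (grad V (theta n w)) ^+ 2).
have step n : integ P (fun w => V (theta n w)) ->
    integ P (fun w => V (theta n.+1 w)) /\
    v n.+1 + gamma n.+1 * llow n.+1 * g2 n <=
    v n + gamma n.+1 * lup n.+1 * M * beta n +
      `|L| * gamma n.+1 ^+ 2 * lup n.+1 ^+ 2 * sigma n.
  move=> Vi; have FM := @filt_measurable _ _ _ _ P _ K Xs n.
  have [Y [Yc Yb]] := bias n.
  have mH i : measurable_fun setT (fun w => Hhat H T K Xs theta n.+1 w i 0).
    have FM' := @filt_measurable _ _ _ _ P _ K Xs n.+1.
    exact: measurable_wrt_measurable FM' _ (sgd_estimator_meas algo i 0).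
  have mH2 : measurable_fun setT
      (fun w => enorm (Hhat H T K Xs theta n.+1 w) ^+ 2).
    rewrite (_ : (fun w => _) = fun w => \sum_i
      Hhat H T K Xs theta n.+1 w i 0 * Hhat H T K Xs theta n.+1 w i 0).
      by apply: measurable_sum => i; exact: measurable_funM.
    by apply/funext => w; rewrite enorm_sqr.
  have [H2i H2s] := integ_of_finite_integral mH2 (fun w => sqr_ge0 _)
    (second_moment n).
  apply: (expected_descent FM V_min V_diff V_smooth grad_M (mth n) (A_meas n)
    _ _ (ltW (gam_gt0 n)) (ltW (low_gt0 n)) (low_up n) Yc _ H2i) => //.
  - by move=> w; have [] := A_posdef n w.
  - move=> w b; have [? [? ?]] := A_bounds n w.
    exact: eigenvalue_bounds.
  - apply: filterS Yb => w; rewrite h_grad => /le_trans; apply.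
    by rewrite ler_wpM2r ?invr_ge0 ?(ltW (T_gt0 n))// ler_wpM2r ?ler_norm ?ltW.
  - rewrite (le_trans H2s)//; apply: le_trans (ler_norm _) _.
    by rewrite normrM (normrM c2) (ger0_norm (sqr_ge0 G)).
  - by move=> w; exact: (sgd_step algo).
have Vi n : integ P (fun w => V (theta n w)).
  elim: n => [|n /step[]//].
  rewrite (_ : (fun w => _) = cst (V theta0)); first exact: integ_cst.
  by apply/funext => w; rewrite (sgd_init algo).
have v0 : v 0%N = V theta0.
  rewrite /v -[RHS](Rint_cst P); apply: eq_Rintegral => w _.
  by rewrite (sgd_init algo).
have v_ge n : V theta_star <= v n.
  rewrite -(Rint_cst P (V theta_star)).
  by apply: le_Rintegral => //; exact: integ_cst.
have [C1 C10 sumC1] := bias_sum_le gamma_pow lup_pow T_pow.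
have [C2 C20 sumC2] := variance_sum_le (ltW a_gt0) gamma_pow lup_pow T_pow.
have [c c0 varpiC] :=
  varpi_ge (addr_ge0 g_ge0 l_ge0) (ltW gl_lt1) gamma_pow llow_pow.
have M0 : 0 <= M by rewrite mulr_ge0 ?sqrtr_ge0 ?ltW.
pose D1 := M * (`|c1| * G) * C1.
pose D2 := `|L| * (`|c2| * G ^+ 2) * C2.
have c1G0 : 0 <= M * (`|c1| * G) by rewrite !mulr_ge0 ?(ltW G_gt0).
have c2G0 : 0 <= `|L| * (`|c2| * G ^+ 2).
  by apply: mulr_ge0 => //; rewrite mulr_ge0 ?sqr_ge0.
have D10 : 0 <= D1 by exact: mulr_ge0.
have D20 : 0 <= D2 by exact: mulr_ge0.
pose D0 := V theta0 - V theta_star.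
have D00 : 0 <= D0 by rewrite subr_ge0.
have sum_g2 N : (4 <= N)%N ->
    \sum_(0 <= k < N.+1) gamma k.+1 * llow k.+1 * g2 k <=
    (D0 + D1 + D2) * (1 + Psi N (a + g - u) + Phi N (2 * g - 2 * u)).
  move=> N4; have N0 : (0 < N)%N by exact: leq_trans N4.
  have tel := @telescoped_recursion R v
    (fun n => gamma n.+1 * llow n.+1 * g2 n)
    (fun n => gamma n.+1 * lup n.+1 * M * beta n +
      `|L| * gamma n.+1 ^+ 2 * lup n.+1 ^+ 2 * sigma n).
  have {}tel := tel (fun n => eq_ind_r (fun x => _ <= x) (step n (Vi n)).2
    (addrA _ _ _)) N.+1.
  move: tel; rewrite v0 big_split/=.
  have -> : \sum_(0 <= k < N.+1) gamma k.+1 * lup k.+1 * M * beta k =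
      M * (`|c1| * G) * \sum_(0 <= k < N.+1) gamma k.+1 * lup k.+1 / T k.+1.
    by rewrite mulr_sumr; apply: eq_bigr => k _; rewrite /beta; ring.
  have -> : \sum_(0 <= k < N.+1) `|L| * gamma k.+1 ^+ 2 * lup k.+1 ^+ 2 * sigma k =
      `|L| * (`|c2| * G ^+ 2) *
      \sum_(0 <= k < N.+1) gamma k.+1 ^+ 2 * lup k.+1 ^+ 2 * `|ln (T k.+1)|.
    by rewrite mulr_sumr; apply: eq_bigr => k _; rewrite /sigma; ring.
  move=> tel.
  have B1 : M * (`|c1| * G) * (\sum_(0 <= k < N.+1) gamma k.+1 * lup k.+1 / T k.+1)
      <= D1 * Psi N (a + g - u).
    by rewrite /D1 -[leRHS]mulrA ler_wpM2l ?sumC1.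
  have B2 : `|L| * (`|c2| * G ^+ 2) *
      (\sum_(0 <= k < N.+1) gamma k.+1 ^+ 2 * lup k.+1 ^+ 2 * `|ln (T k.+1)|)
      <= D2 * Phi N (2 * g - 2 * u).
    by rewrite /D2 -[leRHS]mulrA ler_wpM2l ?sumC2.
  have Ps := Psi_ge0 (a + g - u) N0; have Ph := Phi_ge0 (2 * g - 2 * u) N0.
  apply: (@le_trans _ _ (D0 + D1 * Psi N (a + g - u) +
      D2 * Phi N (2 * g - 2 * u))).
    have := v_ge N.+1; rewrite /D0; lra.
  by nra.
(* [c] is the constant of the lower bound on [varpi] *)
exists ((D0 + D1 + D2) / c); near=> N.
have N4 : (4 <= N)%N by near: N; exact: nbhs_infty_ge.
have N0 : (0 < N)%N by exact: leq_trans N4.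
have w0 : 0 < varpi gamma llow N.
  by rewrite (lt_le_trans _ (varpiC N N0))// mulr_gt0// powR_gt0// ltr0n.
have [Ei Ele] : integ P (fun w => enorm (grad V (theta (tau N w) w)) ^+ 2) /\
    \int[P]_w (enorm (grad V (theta (tau N w) w)) ^+ 2) <=
    \sum_(0 <= n < N.+1) gamma n.+1 * llow n.+1 / varpi gamma llow N * g2 n.
  apply: (@random_index_le _ _ _ P (filt_oo K Xs) _ (tau N) N _
    (fun n w => enorm (grad V (theta n w)) ^+ 2) (M ^+ 2)).
  - apply: smallest_sub; first exact: sigma_algebra_measurable.
    move=> B [n _ nB]; apply: (@filt_measurable _ _ _ _ P _ K Xs n).
    exact: sub_sigma_algebra.
  - exact: tau_indep.
  - by move=> n nN; exact: tau_law.
  - by rewrite -mulr_suml divff// gt_eqF.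
  - move=> n; apply: (measurable_wrt_sub (F := filt K Xs n)).
      by move=> B nB; exists n.
    exact: (@measurable_enorm_grad_sqr _ _ _ _ V_smooth _
      (g_sigma_algebraType (filt K Xs n)) (theta n) (fun i => mtheta n i)).
  - by move=> n w; rewrite sqr_ge0 lerXn2r ?nnegrE ?enorm_ge0.
rewrite unlock gee0_abs; last first.
  by apply: integral_ge0 => w _; rewrite lee_fin sqr_ge0.
rewrite -[X in (X <= _)%E]fineK; last exact: integrable_fin_num.
rewrite lee_fin (le_trans Ele)//.
have Ps := Psi_ge0 (a + g - u) N0; have Ph := Phi_ge0 (2 * g - 2 * u) N0.
set S := 1 + Psi N _ + _.
have S0 : 0 <= S by exact: addr_ge0 (addr_ge0 ler01 Ps) Ph.
rewrite ger0_norm; last by rewrite mulr_ge0// invr_ge0 powR_ge0.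
have -> : \sum_(0 <= n < N.+1) gamma n.+1 * llow n.+1 / varpi gamma llow N * g2 n
   = (\sum_(0 <= n < N.+1) gamma n.+1 * llow n.+1 * g2 n) / varpi gamma llow N.
  by rewrite mulr_suml; apply: eq_bigr => n _; rewrite mulrAC.
apply: (@le_trans _ _ ((D0 + D1 + D2) * S / varpi gamma llow N)).
  by rewrite ler_wpM2r ?invr_ge0 ?(ltW w0)// sum_g2.
have -> (x y z t : R) : x / y * (z^-1 * t) = x * t * (y * z)^-1.
  by rewrite invfM; ring.
apply: ler_wpM2l.
  by apply: mulr_ge0 => //; exact: addr_ge0 (addr_ge0 D00 D10) D20.
by rewrite lef_pV2 ?posrE ?mulr_gt0 ?powR_gt0 ?ltr0n// varpiC.
Unshelve. all: by end_near.
Qed.
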